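(* Let $1<p<\infty$ and let $m\in L^\infty(\mathbb{R},\mathbb{C})$ be a $(p,p)$ Fourier multiplier. Assume that the limits $\ell_+=\lim_{x\to0^+}m(x)$ and $\ell_-=\lim_{x\to0^-}m(x)$ exist and that $\ell=\max\{|\ell_+|,|\ell_-|\}>0$. Then, for every $t>0$, $$|||S_t m|||_{p,p}\ge \ell\,c_p.$$
   Context: For a function $m$ on $\mathbb{R}$ put $m_+(x)=m(x)\chi_{\{x>0\}}$, $m_-(x)=m(x)\chi_{\{x<0\}}$, and for $t\ge0$ let $S_t m(x)=m_+(x-t)+m_-(x+t)$. The Fourier transform is $\hat f(y)=\int_{\mathbb{R}}e^{-2\pi i xy}f(x)\,dx$. For $m\in L^\infty(\mathbb{R},\mathbb{C})$ let $T_mf(x)=\int_{\mathbb{R}}e^{2\pi i xy}m(y)\hat f(y)\,dy$, initially defined for $f\in C_0^\infty(\mathbb{R})$; if $T_m$ extends to a bounded operator on $L^p(\mathbb{R})$, $m$ is called a $(p,p)$ Fourier multiplier. $|||m|||_{p,p}$ denotes the operator norm of $T_m$ on the complex-valued space $L^p(\mathbb{R},\mathbb{C})$. The constant $c_p=|||s|||_{p,p}$ is the multiplier norm of the half-line multiplier $s=\chi_{(0,\infty)}$ on $\mathbb{R}$. *)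

(* Defs.v *)
From HB Require Import structures.
From mathcomp Require Import all_boot all_order all_algebra.
From mathcomp Require Import all_classical all_reals all_analysis.
From mathcomp Require Import complex.

Set Implicit Arguments.
Unset Strict Implicit.
Unset Printing Implicit Defensive.

Import Order.TTheory GRing.Theory Num.Theory.
Import numFieldNormedType.Exports.
Import Normc.

Local Open Scope classical_set_scope.
Local Open Scope ring_scope.
Local Open Scope complex_scope.

Section complex_Lp.
Context {R : realType}.
Implicit Types (f g m : R -> R[i]) (p : \bar R).

Let mu := @lebesgue_measure R.

Definition complex_measurable f : Prop :=
  measurable_fun setT (fun x : R => complex.Re (f x)) /\
  measurable_fun setT (fun x : R => complex.Im (f x)).

Definition complex_integral f : R[i] :=
  (\int[mu]_x complex.Re (f x)) +i* (\int[mu]_x complex.Im (f x)).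

Definition complex_Lnorm p f : \bar R :=
  Lnorm mu p (fun x : R => (normc (f x))%:E).

(* Elements of L^p(R, C) are represented by functions; the identification of
   almost everywhere equal functions is made explicit in [bounded_Lp_operator]. *)
Definition complex_Lfun p f : Prop :=
  complex_measurable f /\ (complex_Lnorm p f < +oo)%E.

Definition smooth (h : R -> R) : Prop :=
  forall (n : nat) (x : R), derivable (derive1n n h) x 1.

Definition Cc_infty f : Prop :=
  [/\ smooth (fun x => complex.Re (f x)),
      smooth (fun x => complex.Im (f x)) &
      compact (closure [set x : R | f x != 0])].

(* [expi a] is exp(i a). *)
Definition expi (a : R) : R[i] := cos a +i* sin a.

Definition fourier f (y : R) : R[i] :=
  complex_integral (fun x => expi (- (2 * pi * x * y)) * f x).

Definition multiplier_op m f (x : R) : R[i] :=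
  complex_integral (fun y => expi (2 * pi * x * y) * (m y * fourier f y)).

(* Linearity holds in L^p, i.e. almost everywhere.  Together with boundedness it
   makes [T] compatible with almost everywhere equality. *)
Definition bounded_Lp_operator p (T : (R -> R[i]) -> (R -> R[i])) : Prop :=
  [/\ forall f, complex_Lfun p f -> complex_Lfun p (T f),
      forall (a : R[i]) f g, complex_Lfun p f -> complex_Lfun p g ->
        ae_eq mu setT (T (fun x => a * f x + g x))
                      (fun x => a * T f x + T g x) &
      exists C : R, forall f, complex_Lfun p f ->
        (complex_Lnorm p (T f) <= C%:E * complex_Lnorm p f)%E].

Definition Lp_operator_norm p (T : (R -> R[i]) -> (R -> R[i])) : \bar R :=
  ereal_sup [set complex_Lnorm p (T f) |
    f in [set f | complex_Lfun p f /\ (complex_Lnorm p f <= 1)%E]].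

Definition extends_multiplier_op p m (T : (R -> R[i]) -> (R -> R[i])) : Prop :=
  bounded_Lp_operator p T /\
  forall f, Cc_infty f -> ae_eq mu setT (T f) (multiplier_op m f).

Definition fourier_multiplier p m : Prop :=
  exists T, extends_multiplier_op p m T.

(* For 1 <= p < +oo the bounded extension of [multiplier_op m] to L^p is unique
   (up to almost everywhere equality) when it exists, so that the infimum is the
   operator norm of that extension; it is +oo when [m] is not a multiplier. *)
Definition multiplier_norm p m : \bar R :=
  ereal_inf [set Lp_operator_norm p T | T in extends_multiplier_op p m].

Definition half_line (x : R) : R[i] := if 0 < x then 1 else 0.

Definition cst_c p : \bar R := multiplier_norm p half_line.

Definition pos_part m (x : R) : R[i] := if 0 < x then m x else 0.

Definition neg_part m (x : R) : R[i] := if x < 0 then m x else 0.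

Definition spread (t : R) m (x : R) : R[i] :=
  pos_part m (x - t) + neg_part m (x + t).

End complex_Lp.

(* Main.v *)
Require Import Defs.
From mathcomp Require Import all_boot all_order all_algebra.
From mathcomp Require Import all_classical all_reals all_analysis measurable_realfun ess_sup_inf.
From mathcomp Require Import complex ring lra.
Set Implicit Arguments.
Unset Strict Implicit.
Unset Printing Implicit Defensive.
Import Order.TTheory GRing.Theory Num.Theory.
Import numFieldNormedType.Exports.
Local Open Scope classical_set_scope.
Local Open Scope ring_scope.
Local Open Scope complex_scope.

(** The lower bound is read off at an edge of the gap that the spreading creates.
    The function M = S_t m vanishes on (-t, t), while M(t + s) = m(s) and
    M(-t - s) = m(-s) for s > 0.  Off the origin, the rescaled functions
    u |-> M(t + u/n) and u |-> M(-t - u/n) therefore converge pointwise to l_+ s and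
    l_- s, where s is the half-line multiplier ([spread_blow_up_right],
    [spread_blow_up_left]).

    Rescaling does not change multiplier norms.  Modulating and dilating the argument
    conjugates T_M into the operator of u |-> M(e u + a) ([multiplier_op_modulate])
    and multiplies all L^p norms by |e|^(-1/p), so that every rescaled operator obeys
    on test functions the bound K of the original one ([multiplier_bound_affine]).
    The Fourier transform of a test function is integrable
    ([Cc_infty_fourier_cintegrable]); by dominated convergence the rescaled operators
    converge at every point when applied to a test function f, and Fatou's lemma gives
    |l| ||T_s f||_p <= K ||f||_p for the limit ([half_line_bound]).

    The constant c_p is an infimum over bounded operators on L^p that extend T_s, so
    one such extension with bound K / |l| has to be produced ([bounded_extension]).  It
    is obtained as the closure of the graph of T_s on test functions, from the density
    of test functions ([Cc_infty_dense]) and the completeness of L^p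
    ([complex_Lp_complete]). *)

(** * Smooth functions and a flat function *)

Section smooth_functions.
Context {R : realType}.
Implicit Types (f g : R -> R) (P : {poly R}).

(** Differentiability of order n, by recursion on the derivative rather than on
    iterated derivatives: closure under products and compositions is then an
    induction on n that uses one application of the Leibniz or chain rule. *)
Fixpoint Cn (n : nat) f : Prop :=
  if n is k.+1 then (forall x : R, derivable f x 1) /\ Cn k (derive1 f) else True.

Lemma smoothP f : smooth f <-> forall n, Cn n f.
Proof.
split=> [sf n|Cf n x].
  elim: n f sf => //= n ih f sf; split; first exact: (sf 0%N).
  by apply: ih => k x; have := sf k.+1 x; rewrite derive1Sn.
elim: n f Cf => [|n ih] f Cf; first exact: (Cf 1%N).1.
by rewrite derive1Sn; apply: ih => k; have [] := Cf k.+1.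
Qed.

Lemma CnW n f : Cn n.+1 f -> Cn n f.
Proof. by elim: n f => [//|n ih] f /= [df Cf]; split => //; apply: ih. Qed.

Lemma derive1E_is f g : (forall x : R, is_derive x 1 f (g x)) -> derive1 f = g.
Proof. by move=> fg; apply/funext => x; rewrite derive1E; apply: derive_val. Qed.

Lemma Cn_is_derive n f g :
  (forall x : R, is_derive x 1 f (g x)) -> Cn n g -> Cn n.+1 f.
Proof. by move=> fg Cg; split; [move=> x; exact: ex_derive|rewrite (derive1E_is fg)]. Qed.

Lemma Cn_cst n (c : R) : Cn n (fun=> c).
Proof.
elim: n c => // n ih c; apply: (@Cn_is_derive _ _ (fun=> 0)) => // x.
Qed.

Lemma derivable_is f : (forall x : R, derivable f x 1) ->
  forall x : R, is_derive x 1 f (derive1 f x).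
Proof. by move=> df x; rewrite derive1E; apply/derivableP. Qed.

Lemma CnD n f g : Cn n f -> Cn n g -> Cn n (fun x => f x + g x).
Proof.
elim: n f g => // n ih f g [df Cf] [dg Cg].
have {}df := derivable_is df; have {}dg := derivable_is dg.
by apply: (@Cn_is_derive _ _ (fun x => derive1 f x + derive1 g x)) => //; exact: ih.
Qed.

Lemma CnM n f g : Cn n f -> Cn n g -> Cn n (fun x => f x * g x).
Proof.
elim: n f g => // n ih f g Cf Cg.
have Cf1 := CnW Cf; have Cg1 := CnW Cg.
move: Cf Cg => [df Cf] [dg Cg].
have {}df := derivable_is df; have {}dg := derivable_is dg.
apply: (@Cn_is_derive _ _ (fun x => f x * derive1 g x + g x * derive1 f x)) => //.
by apply: CnD; apply: ih.
Qed.

Lemma Cn_comp_affine n f (a b : R) : Cn n f -> Cn n (fun x => f (a * x + b)).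
Proof.
elim: n f => // n ih f [df Cf].
have {}df := derivable_is df.
apply: (@Cn_is_derive _ _ (fun x => a * derive1 f (a * x + b))); last first.
  by apply: CnM; [exact: Cn_cst|exact: ih].
move=> x.
have h : is_derive x 1 (fun x : R => a * x + b) a.
  by apply: is_derive_eq; rewrite /GRing.scale/=; lra.
have := @is_derive1_comp _ f (fun x : R => a * x + b) x _ _ (df _) h.
by rewrite mulrC.
Qed.

Lemma Cn_cos_sin n : Cn n (@cos R) /\ Cn n (@sin R).
Proof.
elim: n => // n [ihc ihs]; split.
  apply: (@Cn_is_derive _ _ (fun x => (-1) * sin x)).
    by move=> x; apply: is_derive_eq; rewrite mulN1r.
  by apply: CnM => //; exact: Cn_cst.
exact: (@Cn_is_derive _ _ cos).
Qed.

Lemma smooth_cst (c : R) : smooth (fun=> c).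
Proof. by apply/smoothP => n; exact: Cn_cst. Qed.

Lemma smoothD f g : smooth f -> smooth g -> smooth (fun x => f x + g x).
Proof. by move=> /smoothP Cf /smoothP Cg; apply/smoothP => n; exact: CnD. Qed.

Lemma smoothM f g : smooth f -> smooth g -> smooth (fun x => f x * g x).
Proof. by move=> /smoothP Cf /smoothP Cg; apply/smoothP => n; exact: CnM. Qed.

Lemma smooth_comp_affine f (a b : R) : smooth f -> smooth (fun x => f (a * x + b)).
Proof. by move=> /smoothP Cf; apply/smoothP => n; exact: Cn_comp_affine. Qed.

Lemma smooth_cos : smooth (@cos R).
Proof. by apply/smoothP => n; have [] := Cn_cos_sin n. Qed.

Lemma smooth_sin : smooth (@sin R).
Proof. by apply/smoothP => n; have [] := Cn_cos_sin n. Qed.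

Lemma smoothN f : smooth f -> smooth (fun x => - f x).
Proof.
move=> sf; have -> : (fun x => - f x) = (fun x => (-1) * f x).
  by apply/funext => x; rewrite mulN1r.
by apply: (@smoothM (fun=> -1) f) => //; exact: smooth_cst.
Qed.

Lemma smooth_derive1 f : smooth f -> smooth (derive1 f).
Proof. by move=> /smoothP Cf; apply/smoothP => n; have [] := Cf n.+1. Qed.

Lemma smooth_is_derive f (x : R) : smooth f -> is_derive x 1 f (derive1 f x).
Proof. by move=> sf; apply: derivable_is => y; exact: (sf 0%N). Qed.

Lemma smooth_continuous f : smooth f -> continuous f.
Proof.
move=> sf x; apply: differentiable_continuous.
by apply/derivable1_diffP; exact: (sf 0%N).
Qed.

(** The function P(1/x) exp(-1/x) for x > 0, extended by 0.  The polynomial P is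
    there to make the family stable under differentiation. *)
Definition flat P (x : R) : R := if 0 < x then P.[x^-1] * expR (- x^-1) else 0.

Lemma exprn_le_expR (n : nat) (y : R) : 0 <= y ->
  y ^+ n.+1 <= (n.+1)`!%:R * expR y.
Proof.
move=> y0; rewrite mulrC -ler_pdivrMr ?ltr0n ?fact_gt0//.
by apply: le_trans (expR_ge1Dxn n y0); rewrite lerDr.
Qed.

(** Since exp(y) dominates y^(k+2) for every k, the function vanishes to second
    order at 0; this is what gives it the derivative 0 there. *)
Lemma flat_le_sqr P : exists2 C : R, 0 <= C & forall x, `|flat P x| <= C * x ^+ 2.
Proof.
exists (\sum_(i < size P) `|P`_i| * (i.+2)`!%:R).
  by apply: sumr_ge0 => i _; rewrite mulr_ge0.
move=> x; rewrite /flat; case: ifPn => [x0|_]; last first.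
  rewrite normr0 mulr_ge0 ?sqr_ge0//.
  by apply: sumr_ge0 => i _; rewrite mulr_ge0.
rewrite normrM horner_coef (ger0_norm (expR_ge0 _)) mulr_suml.
apply: (le_trans (ler_wpM2r (expR_ge0 _) (ler_norm_sum _ _ _))).
rewrite mulr_suml; apply: ler_sum => i _.
rewrite normrM -!mulrA ler_wpM2l// normrX ger0_norm ?invr_ge0 ?(ltW x0)//.
rewrite expRN ler_pdivrMr ?expR_gt0// -mulrA.
rewrite [x ^+ 2 * _]mulrC mulrA -ler_pdivrMr ?exprn_gt0//.
rewrite -exprVn -exprD addn2; apply: exprn_le_expR.
by rewrite invr_ge0 ltW.
Qed.

(** For x > 0 differentiation acts on the polynomial as P |-> X^2 (P - P'); at 0
    the difference quotient is bounded by C |h|. *)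
Lemma is_derive_flat P (x : R) :
  is_derive x 1 (flat P) (flat ('X ^+ 2 * (P - P^`())) x).
Proof.
have [x0|x0|->] := ltgtP x 0.
- rewrite [X in is_derive _ _ _ X]/flat ltNge (ltW x0)/=.
  apply: (@near_eq_is_derive _ _ _ (fun=> 0)).
    by near=> z; rewrite /flat ltNge ltW//; near: z; exact: lt_nbhsl.
- rewrite [X in is_derive _ _ _ X]/flat x0.
  have xn0 : x != 0 by rewrite gt_eqF.
  pose g := fun z : R => P.[z^-1] * expR (- z^-1).
  apply: (@near_eq_is_derive _ _ _ g).
    by near=> z; rewrite /flat ifT//; near: z; exact: lt_nbhsr.
  have hV : is_derive x 1 (fun z : R => z^-1) (- x ^- 2 * 1).
    exact: (@is_deriveV _ id x 1 1 xn0 (is_derive_id _ _)).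
  have hP : is_derive x 1 (fun z : R => P.[z^-1]) (P^`().[x^-1] * (- x ^- 2 * 1)).
    have := @is_derive1_comp _ (horner P) (fun z : R => z^-1) x _ _ (is_derive_poly _ _) hV.
    by [].
  have hE : is_derive x 1 (fun z : R => expR (- z^-1)) (expR (- x^-1) * (- (- x ^- 2 * 1))).
    have := @is_derive1_comp _ expR (fun z : R => - z^-1) x _ _ (is_derive_expR _) (is_deriveN hV).
    by [].
  have hg : is_derive x 1 g _ := is_deriveM hP hE.
  apply: (is_derive_eq hg).
  rewrite /GRing.scale/= !hornerE/= -exprVn; ring.
- rewrite [X in is_derive _ _ _ X]/flat ltxx.
  have [C C0 hC] := flat_le_sqr P.
  have h0 : flat P 0 = 0 by rewrite /flat ltxx.
  have cv : (fun h : R => h^-1 *: (flat P (h *: 1 + 0) - flat P 0)) @ 0^' --> (0 : R).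
    apply/cvgrPdist_le => /= e e0; near=> h.
    have hn0 : h != 0 by near: h; exact: nbhs_dnbhs_neq.
    rewrite sub0r normrN h0 subr0 addr0 /GRing.scale/= mulr1 normrM normfV.
    rewrite ler_pdivrMl ?normr_gt0//.
    apply: (le_trans (hC _)); rewrite -real_normK ?num_real// expr2.
    rewrite mulrCA ler_wpM2l//.
    have : `|h| <= e / (C + 1).
      by near: h; apply: dnbhs0_le; rewrite divr_gt0// ltr_wpDl.
    rewrite ler_pdivlMr ?ltr_wpDl// => /(le_trans _); apply.
    by rewrite mulrC ler_wpM2l// lerDl.
  apply: DeriveDef; first by apply/cvg_ex; exists 0; exact: cv.
  by apply/cvg_lim => //; exact: cv.
Unshelve. all: by end_near. Qed.

Lemma smooth_flat P : smooth (flat P).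
Proof.
apply/smoothP => n; elim: n P => // n ih P.
exact: Cn_is_derive (is_derive_flat P) (ih _).
Qed.

End smooth_functions.

Arguments smooth_cst {R} c n x.
Arguments smoothD {R f g} _ _ n x.
Arguments smoothM {R f g} _ _ n x.
Arguments smoothN {R f} _ n x.
Arguments smooth_comp_affine {R f} a b _ n x.
Arguments smooth_cos {R} n x.
Arguments smooth_sin {R} n x.
Arguments smooth_derive1 {R f} _ n x.
Arguments smooth_flat {R} P n x.
Arguments smooth_is_derive {R f} x _.
Arguments smooth_continuous {R f} _ x.

(** * Modulus, real and imaginary parts *)

Section complex_modulus.
Context {R : realType}.
Implicit Types (z w : R[i]).

Lemma normc_ge0 z : 0 <= Normc.normc z.
Proof. by case: z => a b; exact: sqrtr_ge0. Qed.

Lemma Re_le_normc z : `|complex.Re z| <= Normc.normc z.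
Proof. by case: z => a b /=; rewrite -sqrtr_sqr ler_wsqrtr// lerDl sqr_ge0. Qed.

Lemma Im_le_normc z : `|complex.Im z| <= Normc.normc z.
Proof. by case: z => a b /=; rewrite -sqrtr_sqr ler_wsqrtr// lerDr sqr_ge0. Qed.

Lemma normc_le_ReIm z : Normc.normc z <= `|complex.Re z| + `|complex.Im z|.
Proof.
case: z => a b /=; rewrite -[leRHS]ger0_norm ?addr_ge0// -sqrtr_sqr ler_wsqrtr//.
by rewrite sqrrD !real_normK ?num_real// lerD2r lerDl mulrn_wge0 ?mulr_ge0.
Qed.

Lemma normc_expi (a : R) : Normc.normc (expi a) = 1.
Proof. by rewrite /= cos2Dsin2 sqrtr1. Qed.

Lemma expiD (a b : R) : expi (a + b) = expi a * expi b.
Proof.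
apply/eqP; rewrite eq_complex /= cosD sinD.
by apply/andP; split; apply/eqP; ring.
Qed.

Lemma normc_sub z w : Normc.normc (z - w) = Normc.normc (w - z).
Proof. by rewrite -normcN opprB. Qed.

Lemma normc_real (a : R) : Normc.normc (a%:C) = `|a|.
Proof. by rewrite /= expr0n/= addr0 sqrtr_sqr. Qed.

Lemma Re_mulc z w : complex.Re (z * w) =
  complex.Re z * complex.Re w - complex.Im z * complex.Im w.
Proof. by case: z => a b; case: w. Qed.

Lemma Im_mulc z w : complex.Im (z * w) =
  complex.Re z * complex.Im w + complex.Im z * complex.Re w.
Proof. by case: z => a b; case: w. Qed.

Lemma Re_addc z w : complex.Re (z + w) = complex.Re z + complex.Re w.
Proof. by case: z => a b; case: w. Qed.

Lemma Im_addc z w : complex.Im (z + w) = complex.Im z + complex.Im w.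
Proof. by case: z => a b; case: w. Qed.

End complex_modulus.

(** * Test functions *)

Section test_functions.
Context {R : realType}.
Implicit Types (f g : R -> R[i]).

(** Vanishing outside a ball is the form of the support condition that sums,
    dilations and derivatives inherit at once. *)
Lemma Cc_inftyP f : Cc_infty f <->
  [/\ smooth (fun x => complex.Re (f x)), smooth (fun x => complex.Im (f x)) &
      exists B : R, forall x, B < `|x| -> f x = 0].
Proof.
split=> -[sr si cf]; split => //.
- have [M [_ hM]] := compact_bounded cf.
  exists (M + 1) => x Mx; apply/eqP; apply: contraPT Mx => fx0.
  by apply/negP; rewrite -leNgt; apply: (hM (M + 1)); [rewrite ltrDl|exact: subset_closure].
- have [B hB] := cf.
  apply: (@subclosed_compact _ _ `[-B, B]); [exact: closed_closure|exact: segment_compact|].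
  rewrite [X in _ `<=` X](_ : _ = closure `[-B, B]).
    apply: closure_subset => x /= fx0; rewrite in_itv/= -ler_norml leNgt.
    by apply: contra fx0 => /hB ->.
  by apply/closure_id; exact: itv_closed.
Qed.

Lemma Cc_infty_lin (a : R[i]) f g :
  Cc_infty f -> Cc_infty g -> Cc_infty (fun x => a * f x + g x).
Proof.
move=> /Cc_inftyP[fr fi [B hB]] /Cc_inftyP[gr gi [D hD]]; apply/Cc_inftyP; split.
- have -> : (fun x => complex.Re (a * f x + g x)) = (fun x =>
      complex.Re a * complex.Re (f x) + - (complex.Im a * complex.Im (f x))
      + complex.Re (g x)) by apply/funext => x; rewrite Re_addc Re_mulc.
  exact (smoothD (smoothD (smoothM (smooth_cst _) fr)
    (smoothN (smoothM (smooth_cst _) fi))) gr).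
- have -> : (fun x => complex.Im (a * f x + g x)) = (fun x =>
      complex.Re a * complex.Im (f x) + complex.Im a * complex.Re (f x)
      + complex.Im (g x)) by apply/funext => x; rewrite Im_addc Im_mulc.
  exact (smoothD (smoothD (smoothM (smooth_cst _) fi)
    (smoothM (smooth_cst _) fr)) gi).
- exists (Num.max B D) => x; rewrite gt_max => /andP[/hB -> /hD ->].
  by rewrite mulr0 addr0.
Qed.

(** Dilation by e followed by modulation with frequency a.  Negative e are
    used: they reflect the frequency axis. *)
Definition modulate (a e : R) f (x : R) : R[i] := expi (2 * pi * a * x) * f (e * x).

Lemma Cc_infty_modulate (a e : R) f : e != 0 ->
  Cc_infty f -> Cc_infty (modulate a e f).
Proof.
move=> e0 /Cc_inftyP[fr fi [B hB]].
have dil (h : R -> R) (c : R) : smooth h -> smooth (fun x => h (c * x)).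
  move=> sh; have -> : (fun x => h (c * x)) = (fun x => h (c * x + 0)).
    by apply/funext => x; rewrite addr0.
  exact: smooth_comp_affine.
have cosax := dil cos (2 * pi * a) smooth_cos.
have sinax := dil sin (2 * pi * a) smooth_sin.
have fre := dil _ e fr; have fie := dil _ e fi.
apply/Cc_inftyP; split.
- have -> : (fun x => complex.Re (modulate a e f x)) = (fun x =>
      cos (2 * pi * a * x) * complex.Re (f (e * x))
      + - (sin (2 * pi * a * x) * complex.Im (f (e * x)))).
    by apply/funext => x; rewrite Re_mulc.
  exact (smoothD (smoothM cosax fre) (smoothN (smoothM sinax fie))).
- have -> : (fun x => complex.Im (modulate a e f x)) = (fun x =>
      cos (2 * pi * a * x) * complex.Im (f (e * x))
      + sin (2 * pi * a * x) * complex.Re (f (e * x))).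
    by apply/funext => x; rewrite Im_mulc.
  exact (smoothD (smoothM cosax fie) (smoothM sinax fre)).
- exists (`|e|^-1 * B) => x Bx; rewrite /modulate hB ?mulr0//.
  by rewrite normrM -ltr_pdivrMl// normr_gt0.
Qed.

Definition cderive1 f (x : R) : R[i] :=
  derive1 (fun x => complex.Re (f x)) x +i* derive1 (fun x => complex.Im (f x)) x.

Lemma derive1_near0 (h : R -> R) (x : R) : (\near x, h x = 0) -> derive1 h x = 0.
Proof.
move=> hx; rewrite derive1E.
apply: (@derive_val _ _ _ _ _ h).
apply: (@near_eq_is_derive _ _ _ (fun=> 0) h).
  by apply: filterS hx => z ->.
Qed.

Lemma Cc_infty_cderive1 f : Cc_infty f -> Cc_infty (cderive1 f).
Proof.
move=> /Cc_inftyP[fr fi [B hB]]; apply/Cc_inftyP; split.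
- exact: smooth_derive1 fr.
- exact: smooth_derive1 fi.
- exists B => x Bx.
  have nz : \near x, f x = 0.
    apply/nbhs_ballP; exists (`|x| - B) => /=; first by rewrite subr_gt0.
    move=> z; rewrite /ball/= => xz; apply: hB.
    by move: (le_lt_trans (lerB_dist x z) xz); rewrite ltrBlDr; lra.
  rewrite /cderive1 !derive1_near0 //; by apply: filterS nz => z ->.
Qed.

(** As k grows this increases to the indicator of ]a, b[, so that test functions
    approximate indicators without any normalization by a quotient. *)
Definition smooth_bump (a b k : R) (x : R) : R[i] :=
  (flat 1 (k * (x - a)) * flat 1 (k * (b - x)))%:C.

Lemma smooth_bumpE (a b k x : R) : 0 < k -> smooth_bump a b k x =
  if (a < x) && (x < b)
  then (expR (- (k * (x - a))^-1) * expR (- (k * (b - x))^-1))%:C else 0.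
Proof.
move=> k0; rewrite /smooth_bump /flat !pmulr_rgt0// !subr_gt0 !hornerE.
by case: (a < x); case: (x < b); rewrite ?mulr0 ?mul0r ?mul1r.
Qed.

Lemma Cc_infty_smooth_bump (a b k : R) : 0 < k -> Cc_infty (smooth_bump a b k).
Proof.
move=> k0; apply/Cc_inftyP; split.
- have -> : (fun x => complex.Re (smooth_bump a b k x)) =
      (fun x => flat 1 (k * x + (- k * a)) * flat 1 (- k * x + k * b)).
    apply/funext => x /=; congr (flat _ _ * flat _ _); ring.
  exact (smoothM (smooth_comp_affine _ _ (smooth_flat _)) (smooth_comp_affine _ _ (smooth_flat _))).
- exact: smooth_cst.
- exists (Num.max `|a| `|b|) => x; rewrite gt_max => /andP[ax bx].
  rewrite smooth_bumpE//; case: ifPn => // /andP[ax' bx']; exfalso.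
  move: ax bx; have [x0|x0] := leP 0 x.
    rewrite (ger0_norm x0) => _ /(le_lt_trans (ler_norm _)).
    by rewrite ltNge (ltW bx').
  rewrite (ltr0_norm x0) => + _; rewrite -normrN => /(le_lt_trans (ler_norm _)).
  by rewrite ltrN2 ltNge (ltW ax').
Qed.

End test_functions.

(** * Measurability of complex functions *)

Section measurability.
Context {R : realType}.
Implicit Types (f g : R -> R[i]).

Lemma cvg_powR (p : R) (u : R^nat) (l : R) : 0 < p -> (forall n, 0 <= u n) ->
  u @ \oo --> l -> (fun n => u n `^ p) @ \oo --> l `^ p.
Proof.
move=> p0 u0 ul.
have l0 : 0 <= l.
  by rewrite -(cvg_lim _ ul)//; apply: limr_ge; [apply/cvg_ex; exists l|apply: nearW].
move: l0; rewrite le_eqVlt => /predU1P[l0|l0].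
  rewrite -l0 powR0 ?gt_eqF//; apply/cvgrPdist_le => /= e e0.
  have ep : 0 < e `^ p^-1 by rewrite powR_gt0.
  move/cvgrPdist_le : ul => /(_ _ ep); rewrite -l0.
  apply: filterS => n; rewrite !sub0r !normrN ger0_norm// => un.
  rewrite ger0_norm ?powR_ge0//.
  have := @ge0_ler_powR _ _ (ltW p0) _ _ _ _ un; rewrite !nnegrE u0 (ltW ep) => /(_ erefl erefl).
  by rewrite -powRrM mulVf ?gt_eqF// powRr1// ltW.
apply: (@continuous_cvg _ _ _ \oo _ u (fun x => x `^ p)) => //.
apply: differentiable_continuous; apply/derivable1_diffP.
by apply: derivable_powR; rewrite in_itv/= l0.
Qed.

Lemma complex_measurable_normc f : complex_measurable f ->
  measurable_fun setT (fun x => Normc.normc (f x)).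
Proof.
move=> [fr fi].
have -> : (fun x => Normc.normc (f x)) = Num.sqrt \o
    (fun x => complex.Re (f x) ^+ 2 + complex.Im (f x) ^+ 2).
  by apply/funext => x /=; case: (f x).
apply: measurableT_comp.
  by apply: continuous_measurable_fun; exact: sqrt_continuous.
by apply: measurable_funD; apply: measurable_funX.
Qed.

Lemma complex_measurable_pow f (p : R) : complex_measurable f ->
  measurable_fun setT (fun x => (Normc.normc (f x) `^ p)%:E).
Proof.
move=> mf; apply/measurable_EFinP.
exact: measurableT_comp (measurable_powR p) (complex_measurable_normc mf).
Qed.

Lemma complex_measurableD f g : complex_measurable f -> complex_measurable g ->
  complex_measurable (fun x => f x + g x).
Proof.
move=> [fr fi] [gr gi]; split.
  have -> : (fun x => complex.Re (f x + g x)) =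
    (fun x => complex.Re (f x) + complex.Re (g x)) by apply/funext => x; rewrite Re_addc.
  exact: measurable_funD.
have -> : (fun x => complex.Im (f x + g x)) =
  (fun x => complex.Im (f x) + complex.Im (g x)) by apply/funext => x; rewrite Im_addc.
exact: measurable_funD.
Qed.

Lemma complex_measurableM f g : complex_measurable f -> complex_measurable g ->
  complex_measurable (fun x => f x * g x).
Proof.
move=> [fr fi] [gr gi]; split.
  have -> : (fun x => complex.Re (f x * g x)) =
    (fun x => complex.Re (f x) * complex.Re (g x) - complex.Im (f x) * complex.Im (g x))
    by apply/funext => x; rewrite Re_mulc.
  by apply: measurable_funB; exact: measurable_funM.
have -> : (fun x => complex.Im (f x * g x)) =
  (fun x => complex.Re (f x) * complex.Im (g x) + complex.Im (f x) * complex.Re (g x))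
  by apply/funext => x; rewrite Im_mulc.
by apply: measurable_funD; exact: measurable_funM.
Qed.

Lemma complex_measurable_cst (a : R[i]) : complex_measurable (fun=> a : R[i]).
Proof. by split; exact: measurable_cst. Qed.

Lemma complex_measurable_lin (a : R[i]) f g : complex_measurable f -> complex_measurable g ->
  complex_measurable (fun x => a * f x + g x).
Proof.
move=> mf mg; apply: complex_measurableD => //.
by apply: complex_measurableM => //; exact: complex_measurable_cst.
Qed.

Lemma complex_measurableB f g : complex_measurable f -> complex_measurable g ->
  complex_measurable (fun x => f x - g x).
Proof.
move=> mf mg; have -> : (fun x => f x - g x) = (fun x => -1 * g x + f x).
  by apply/funext => x; rewrite mulN1r addrC.
exact: complex_measurable_lin.
Qed.

Lemma complex_measurable_real (f : R -> R) : measurable_fun setT f ->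
  complex_measurable (fun x => (f x)%:C).
Proof. by move=> mf; split => //; exact: measurable_cst. Qed.

Lemma complex_measurable_comp f (h : R -> R) : measurable_fun setT h -> complex_measurable f ->
  complex_measurable (fun x => f (h x)).
Proof.
move=> mh [fr fi]; split.
  exact: (measurableT_comp fr mh).
exact: (measurableT_comp fi mh).
Qed.

Lemma complex_measurable_expi (h : R -> R) : measurable_fun setT h ->
  complex_measurable (fun x => expi (h x)).
Proof.
move=> mh; split => /=; apply: measurableT_comp => //; apply: continuous_measurable_fun.
  exact: continuous_cos.
exact: continuous_sin.
Qed.

Lemma complex_measurable_Cc f : Cc_infty f -> complex_measurable f.
Proof.
move=> [fr fi _]; split; apply: continuous_measurable_fun.
  exact: smooth_continuous fr.
exact: smooth_continuous fi.
Qed.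

End measurability.

(** * The norm of complex L^p *)

Lemma ae_lebesgue_filter (R : realType) :
  Filter (nbhs (almost_everywhere (@lebesgue_measure R))).
Proof. exact: ae_filter_ringOfSetsType. Qed.

Lemma ae_imp (R : realType) (P Q : R -> Prop) : (forall x, P x -> Q x) ->
  {ae (@lebesgue_measure R), forall x, P x} ->
  {ae (@lebesgue_measure R), forall x, Q x}.
Proof. exact: (@filterS _ _ (ae_lebesgue_filter R)). Qed.

Lemma ae_imp2 (R : realType) (P P' Q : R -> Prop) :
  (forall x, P x -> P' x -> Q x) ->
  {ae (@lebesgue_measure R), forall x, P x} ->
  {ae (@lebesgue_measure R), forall x, P' x} ->
  {ae (@lebesgue_measure R), forall x, Q x}.
Proof. exact: (@filterS2 _ _ (ae_lebesgue_filter R)). Qed.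

Lemma ae_all (R : realType) (Q : R -> Prop) : (forall x, Q x) ->
  {ae (@lebesgue_measure R), forall x, Q x}.
Proof. by move=> h; apply: (@filterE _ _ (ae_lebesgue_filter R)). Qed.

Section complex_Lp_norm.
Context {R : realType}.
Variable p : R.
Hypothesis p1 : 1 <= p.
Local Notation mu := (@lebesgue_measure R).
Implicit Types (f g : R -> R[i]).
Local Notation N f := (complex_Lnorm p%:E f%R).

Let p0 : 0 < p. Proof. exact: lt_le_trans p1. Qed.

Lemma complex_LnormE f :
  N f = ((\int[mu]_x (Normc.normc (f x) `^ p)%:E) `^ p^-1)%E.
Proof.
rewrite /complex_Lnorm unlock; congr (_ `^ _)%E; apply: eq_integral => x _.
by rewrite abse_EFin poweR_EFin ger0_norm// normc_ge0.
Qed.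

Lemma complex_Lnorm_ge0 f : (0 <= N f)%E.
Proof. exact: Lnorm_ge0. Qed.

Lemma int_pow_ge0 f : (0 <= \int[mu]_x (Normc.normc (f x) `^ p)%:E)%E.
Proof. by apply: integral_ge0 => x _; rewrite lee_fin powR_ge0. Qed.

(** Trades the p-th root for the integral of the p-th power, to which the
    convergence theorems for integrals apply. *)
Lemma complex_Lnorm_leP f (K : R) : 0 <= K ->
  (N f <= K%:E)%E <-> (\int[mu]_x (Normc.normc (f x) `^ p)%:E <= (K `^ p)%:E)%E.
Proof.
move=> K0; rewrite complex_LnormE; split => h.
  have := @gt0_ler_poweR _ _ (ltW p0) _ _ _ _ h.
  rewrite -poweRrM mulVf ?gt_eqF// poweRe1 ?int_pow_ge0//.
  by rewrite poweR_EFin; apply; rewrite in_itv/= ?poweR_ge0 ?lee_fin ?K0 ?leey.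
have := @gt0_ler_poweR _ p^-1 _ _ _ _ _ h.
rewrite -poweR_EFin -poweRrM mulfV ?gt_eqF// poweRe1 ?lee_fin//.
apply; rewrite ?invr_ge0 ?(ltW p0)//.
  by rewrite in_itv/= int_pow_ge0 leey.
by rewrite in_itv/= ?poweR_ge0 ?lee_fin ?powR_ge0 ?leey.
Qed.

Lemma complex_Lnorm_lty f :
  (N f < +oo)%E <-> (\int[mu]_x (Normc.normc (f x) `^ p)%:E < +oo)%E.
Proof.
rewrite complex_LnormE; split; last exact: poweR_lty.
by apply: lty_poweRy; rewrite invr_eq0 gt_eqF.
Qed.

Lemma complex_Lnorm_le_ae f g : complex_measurable f -> complex_measurable g ->
  {ae mu, forall x, Normc.normc (f x) <= Normc.normc (g x)} -> (N f <= N g)%E.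
Proof.
move=> mf mg fg; rewrite !complex_LnormE; apply: gt0_ler_poweR.
- by rewrite invr_ge0 ltW.
- by rewrite in_itv/= int_pow_ge0 leey.
- by rewrite in_itv/= int_pow_ge0 leey.
- apply: ae_ge0_le_integral => //.
  + by move=> x _; rewrite lee_fin powR_ge0.
  + exact: complex_measurable_pow.
  + by move=> x _; rewrite lee_fin powR_ge0.
  + exact: complex_measurable_pow.
  + apply: ae_imp fg => x fg _; rewrite lee_fin; apply: ge0_ler_powR => //.
    * exact: ltW.
    * by rewrite nnegrE normc_ge0.
    * by rewrite nnegrE normc_ge0.
Qed.

Lemma complex_Lnorm_ae_eq f g : complex_measurable f -> complex_measurable g ->
  ae_eq mu setT f g -> N f = N g.
Proof.
move=> mf mg fg; apply/eqP; rewrite eq_le; apply/andP; split;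
  apply: complex_Lnorm_le_ae => //; by apply: ae_imp fg => x /(_ I) ->.
Qed.

Lemma eq_complex_Lnorm f g :
  (forall x, Normc.normc (f x) = Normc.normc (g x)) -> N f = N g.
Proof. by move=> fg; apply: eq_Lnorm => x; rewrite fg. Qed.

(** Minkowski's inequality for the moduli, combined with the pointwise triangle
    inequality. *)
Lemma complex_LnormD f g : complex_measurable f -> complex_measurable g ->
  (N (fun x => f x + g x) <= N f + N g)%E.
Proof.
move=> mf mg.
have mf' := complex_measurable_normc mf; have mg' := complex_measurable_normc mg.
have := @minkowski_EFin _ _ _ mu _ _ _ mf' mg' p1.
apply: le_trans.
have -> : Lnorm mu p%:E (EFin \o
    ((fun x => Normc.normc (f x)) \+ (fun x => Normc.normc (g x)))) =
  N (fun x => (Normc.normc (f x) + Normc.normc (g x))%:C).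
  apply: eq_Lnorm => x /=; congr EFin.
  by rewrite expr0n/= addr0 sqrtr_sqr ger0_norm// addr_ge0// normc_ge0.
apply: complex_Lnorm_le_ae; first exact: complex_measurableD.
  by apply: complex_measurable_real; exact: measurable_funD.
apply: ae_all => x; rewrite normc_real ger0_norm ?addr_ge0 ?normc_ge0//.
exact: le_normcD.
Qed.

Lemma complex_LnormZ (a : R[i]) f : complex_measurable f ->
  N (fun x => a * f x) = ((Normc.normc a)%:E * N f)%E.
Proof.
move=> mf; rewrite !complex_LnormE.
under eq_integral do rewrite Normc.normcM powRM ?normc_ge0// EFinM.
rewrite ge0_integralZl//.
- rewrite poweRM ?int_pow_ge0 ?lee_fin ?powR_ge0//.
  by rewrite poweR_EFin -powRrM mulfV ?gt_eqF// powRr1// normc_ge0.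
- exact: complex_measurable_pow.
- by move=> x _; rewrite lee_fin powR_ge0.
- by rewrite lee_fin powR_ge0.
Qed.

Lemma complex_LnormN f : N (fun x => - f x) = N f.
Proof. by apply: eq_complex_Lnorm => x; rewrite normcN. Qed.

Lemma complex_LnormB f g : complex_measurable f -> complex_measurable g ->
  (N (fun x => f x - g x) <= N f + N g)%E.
Proof.
move=> mf mg; rewrite -(complex_LnormN g); apply: complex_LnormD => //.
have -> : (fun x => - g x) = (fun x => -1 * g x + 0) by apply/funext => x; rewrite mulN1r addr0.
by apply: complex_measurable_lin => //; exact: complex_measurable_cst.
Qed.

Lemma complex_Lnorm0 : N (fun=> 0) = 0%E.
Proof.
rewrite complex_LnormE; under eq_integral do rewrite Normc.normc0 powR0 ?gt_eqF//.
by rewrite integral0 poweR0r// invr_eq0 gt_eqF.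
Qed.

Lemma complex_Lfun_lin (a : R[i]) f g :
  complex_Lfun p%:E f -> complex_Lfun p%:E g -> complex_Lfun p%:E (fun x => a * f x + g x).
Proof.
move=> [mf Nf] [mg Ng]; split; first exact: complex_measurable_lin.
apply: le_lt_trans (complex_LnormD _ _) _ => //.
  by apply: complex_measurableM => //; exact: complex_measurable_cst.
by rewrite complex_LnormZ// lte_add_pinfty// lte_mul_pinfty ?lee_fin ?normc_ge0.
Qed.

Lemma complex_Lfun0 : complex_Lfun p%:E (fun=> 0 : R[i]).
Proof. by split; [exact: complex_measurable_cst|rewrite complex_Lnorm0]. Qed.

Lemma complex_Lnorm0_ae f : complex_measurable f -> N f = 0%E -> ae_eq mu setT f (fun=> 0).
Proof.
move=> mf Nf0.
have := @Lnorm_eq0_eq0 _ _ _ mu (fun x => (Normc.normc (f x))%:E) p%:E.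
move=> h; apply: ae_imp (h _ _ Nf0) => [x /= fx _||].
- by move/(_ I) : fx => [] /Normc.eq0_normc.
- by apply/measurable_EFinP; exact: complex_measurable_normc.
- by rewrite lte_fin.
Qed.

End complex_Lp_norm.

(** * Limit theorems and completeness of L^p *)

Section Lp_limits.
Context {R : realType}.
Variable p : R.
Hypothesis p1 : 1 <= p.
Local Notation mu := (@lebesgue_measure R).
Implicit Types (f g : R -> R[i]).
Local Notation N f := (complex_Lnorm p%:E f%R).

Let p0 : 0 < p. Proof. exact: lt_le_trans p1. Qed.

Lemma cvg_normc (u : nat -> R[i]) (l : R[i]) :
  (fun n => Normc.normc (u n - l)) @ \oo --> (0 : R) ->
  (fun n => Normc.normc (u n)) @ \oo --> Normc.normc l.
Proof.
move=> ul; apply/cvgrPdist_le => /= e e0; move/cvgrPdist_le : ul => /(_ _ e0).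
apply: filterS => n; rewrite sub0r normrN ger0_norm ?normc_ge0// => h.
rewrite ler_norml; apply/andP; split.
  have := le_normcD (u n - l) l; rewrite subrK; lra.
have := le_normcD (l - u n) (u n); rewrite subrK (normc_sub l); lra.
Qed.

(** Fatou's lemma for the p-th powers: the L^p norm is lower semicontinuous under
    convergence almost everywhere. *)
Lemma complex_Lnorm_fatou (u : nat -> R -> R[i]) f (K : R) : 0 <= K ->
  (forall n, complex_measurable (u n)) -> complex_measurable f ->
  {ae mu, forall x, (fun n => Normc.normc (u n x - f x)) @ \oo --> (0 : R)} ->
  (forall n, (N (u n) <= K%:E)%E) -> (N f <= K%:E)%E.
Proof.
move=> K0 mu_ mf uf uK; apply/complex_Lnorm_leP => //.
pose G n x := (Normc.normc (u n x) `^ p)%:E.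
have G0 n x : setT x -> (0 <= G n x)%E by rewrite lee_fin powR_ge0.
have mG n : measurable_fun setT (G n) by exact: complex_measurable_pow.
apply: (@le_trans _ _ (\int[mu]_x limn_einf (G^~ x))%E).
  apply: ae_ge0_le_integral => //.
  - by move=> x _; rewrite lee_fin powR_ge0.
  - exact: complex_measurable_pow.
  - move=> x _; rewrite limn_einf_lim; apply: lime_ge; first exact: is_cvg_einfs.
    apply: nearW => n; apply: le_ereal_inf_tmp => y [m _ <-]; exact: (G0 m x I).
  - rewrite (_ : (fun x => limn_einf (G^~ x)) = (fun x => - limn_esup (fun n => - G n x)))%E.
      apply: measurableT_comp => //.
      apply: measurable_fun_limn_esup => n.
      exact: (measurableT_comp (@oppe_measurable R setT) (mG n)).
    apply/funext => x; rewrite -limn_einfN; congr limn_einf.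
    by apply/funext => n; rewrite [RHS]oppeK.
  - apply: ae_imp uf => x uf _.
    have Gx : G^~ x @ \oo --> (Normc.normc (f x) `^ p)%:E.
      apply: cvg_EFin; first exact: nearW.
      by apply: cvg_powR => //; [move=> n; exact: normc_ge0|exact: cvg_normc].
    by rewrite is_cvg_limn_einfE; [rewrite (cvg_lim _ Gx)|apply/cvg_ex; eexists; exact: Gx].
apply: le_trans (fatou mu measurableT mG G0) _.
rewrite limn_einf_lim; apply: lime_le; first exact: is_cvg_einfs.
apply: nearW => n; apply: (@le_trans _ _ (\int[mu]_x G n x)%E).
  by apply: ereal_inf_lbound; exists n => //=.
by apply/complex_Lnorm_leP.
Qed.

Lemma complex_Lnorm_dominated (u : nat -> R -> R[i]) (g : R -> R[i]) :
  (forall n, complex_measurable (u n)) -> complex_Lfun p%:E g ->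
  (forall x, (fun n => Normc.normc (u n x)) @ \oo --> (0 : R)) ->
  (forall n x, Normc.normc (u n x) <= Normc.normc (g x)) ->
  forall e : R, 0 < e -> \forall n \near \oo, (N (u n) <= e%:E)%E.
Proof.
move=> mu_ [mg Ng] u0 ug e e0.
pose G n x := (Normc.normc (u n x) `^ p)%:E.
have ig : mu.-integrable setT (fun x => (Normc.normc (g x) `^ p)%:E).
  apply/integrableP; split; first exact: complex_measurable_pow.
  under eq_integral do rewrite gee0_abs ?lee_fin ?powR_ge0//.
  by apply/(complex_Lnorm_lty p1).
have [||||_ _ /=] := @dominated_convergence _ _ _ mu setT measurableT G (cst 0%E) _ _ _ _ ig.
- by move=> n; exact: complex_measurable_pow.
- exact: measurable_cst.
- apply: ae_all => x _; apply: cvg_EFin; first exact: nearW.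
  rewrite -(@powR0 _ p) ?gt_eqF//; apply: cvg_powR => // n; exact: normc_ge0.
- apply: ae_all => x n _; rewrite gee0_abs ?lee_fin ?powR_ge0//.
  by apply: ge0_ler_powR => //; [exact: ltW|rewrite nnegrE normc_ge0..].
rewrite integral0 => /fine_cvgP[fin /cvgrPdist_le]/= /(_ (e `^ p)).
rewrite powR_gt0// => /(_ erefl); apply: filterS2 fin => n fin.
rewrite sub0r normrN => h; apply/complex_Lnorm_leP => //; first exact: ltW.
rewrite -(fineK fin) lee_fin; apply: le_trans h; exact: ler_norm.
Qed.

Lemma sum_half_le2 n : \sum_(k < n) (2^-1 : R) ^+ k <= 2.
Proof.
have : \sum_(k < n) (2^-1 : R) ^+ k = 2 - 2 * 2^-1 ^+ n.
  elim: n => [|n ih]; first by rewrite big_ord0 expr0 mulr1 subrr.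
  by rewrite big_ord_recr/= ih exprS; field.
by move=> ->; rewrite lerBlDr lerDl mulr_ge0// exprn_ge0// invr_ge0.
Qed.

(** Absolute convergence of the telescoping series. *)
Lemma real_series_cvg (a b : R^nat) : (forall n, `|a n.+1 - a n| <= b n) ->
  (exists M, forall n, \sum_(k < n) b k <= M) -> cvgn a.
Proof.
move=> ab [M hM].
have b0 n : 0 <= b n by exact: le_trans (ab n).
have cb : cvgn (series b).
  apply: nondecreasing_is_cvgn.
    by apply/nondecreasing_seqP => n; rewrite /series/= big_nat_recr//= lerDl.
  by exists M => _ [n _ <-]; rewrite /series/= big_mkord.
have ca : cvgn (series (fun n => a n.+1 - a n)).
  apply: normed_cvg; apply: series_le_cvg cb => // n; exact: normr_ge0.
have -> : a = (fun n => series (fun n => a n.+1 - a n) n + a 0%N).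
  by apply/funext => n; rewrite seriesEnat/= telescope_sumr// subrK.
by apply: is_cvgD => //; exact: is_cvg_cst.
Qed.

(** The Riesz-Fischer argument.  The partial sums of the |h_(k+1) - h_k| have norm
    at most 2, so that by monotone convergence their supremum has an integrable
    p-th power; it is then finite almost everywhere, and at such a point the
    sequence h_n converges absolutely. *)
Lemma complex_Lp_complete (h : nat -> R -> R[i]) :
  (forall n, complex_measurable (h n)) ->
  (forall n, (N (fun x => h n.+1 x - h n x) <= ((2^-1) ^+ n)%:E)%E) ->
  exists2 f, complex_measurable f &
    {ae mu, forall x, (fun n => Normc.normc (h n x - f x)) @ \oo --> (0 : R)}.
Proof.
move=> mh Nh.
pose d n x := Normc.normc (h n.+1 x - h n x).
pose S n x := \sum_(k < n) d k x.
have md n : measurable_fun setT (d n).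
  by apply: complex_measurable_normc; exact: complex_measurableB.
have mS n : measurable_fun setT (S n) by apply: measurable_sum => k; exact: md.
have S0 n x : 0 <= S n x by apply: sumr_ge0 => k _; exact: normc_ge0.
have NS n : (N (fun x => (S n x)%:C) <= (\sum_(k < n) (2^-1) ^+ k)%:E)%E.
  elim: n => [|n ih].
    rewrite big_ord0 (_ : (fun x => (S 0%N x)%:C) = (fun=> 0)) ?complex_Lnorm0//.
    by apply/funext => x; rewrite /S big_ord0.
  rewrite big_ord_recr/= EFinD.
  have -> : (fun x => (S n.+1 x)%:C) = (fun x => (S n x)%:C + (d n x)%:C).
    by apply/funext => x; rewrite /S big_ord_recr/= rmorphD.
  apply: le_trans (complex_LnormD p1 _ _) _; [exact: complex_measurable_real..|].
  apply: leeD => //; apply: le_trans (Nh n).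
  rewrite (@eq_complex_Lnorm _ _ _ (fun x => h n.+1 x - h n x))// => x.
  by rewrite normc_real ger0_norm// normc_ge0.
have NS2 n : (\int[mu]_x (S n x `^ p)%:E <= (2 `^ p)%:E)%E.
  have : (N (fun x => (S n x)%:C) <= 2%:E)%E.
    by apply: le_trans (NS n) _; rewrite lee_fin sum_half_le2.
  move/complex_Lnorm_leP => /(_ p1 (ler0n _ 2)).
  by under eq_integral do rewrite normc_real ger0_norm//.
pose G x := limn (fun n => (S n x `^ p)%:E).
have ndS x : nondecreasing_seq (fun n => (S n x `^ p)%:E).
  apply/nondecreasing_seqP => n; rewrite lee_fin; apply: ge0_ler_powR.
  - exact: ltW.
  - by rewrite nnegrE.
  - by rewrite nnegrE.
  - by rewrite /S big_ord_recr/= lerDl normc_ge0.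
have cS x : cvgn (fun n => (S n x `^ p)%:E) by apply: ereal_nondecreasing_is_cvgn; exact: ndS.
have mSp n : measurable_fun setT (fun x => (S n x `^ p)%:E).
  by apply/measurable_EFinP; exact: measurableT_comp (measurable_powR p) (mS n).
have mG : measurable_fun setT G.
  apply: (@emeasurable_fun_cvg _ _ _ setT (fun n x => (S n x `^ p)%:E) G mSp) => x _.
  exact: cS.
have G0 x : (0 <= G x)%E.
  by apply: lime_ge; [exact: cS|apply: nearW => n; rewrite lee_fin powR_ge0].
have iG : mu.-integrable setT G.
  apply/integrableP; split => //.
  under eq_integral do rewrite gee0_abs//.
  rewrite (@monotone_convergence _ _ _ mu setT measurableT (fun n x => (S n x `^ p)%:E))//.
  - apply: (@le_lt_trans _ _ (2 `^ p)%:E); last exact: ltry.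
    apply: lime_le; last exact: (nearW _ NS2).
    apply: ereal_nondecreasing_is_cvgn => m n mn; apply: ge0_le_integral => //.
    + by move=> x _; rewrite lee_fin powR_ge0.
    + exact: mSp.
    + exact: mSp.
    + by move=> x _; exact: ndS.
  - by move=> n x _; rewrite lee_fin powR_ge0.
have aG := integrable_ae measurableT iG.
(* upper limits are measurable without any reference to the set of convergence *)
pose f (x : R) : R[i] :=
  fine (limn_esup (fun n => (complex.Re (h n x))%:E)) +i*
  fine (limn_esup (fun n => (complex.Im (h n x))%:E)).
exists f.
  split => /=; apply: measurableT_comp => //; apply: measurable_fun_limn_esup => n;
    apply/measurable_EFinP; exact: (mh n).1 || exact: (mh n).2.
apply: ae_imp aG => x /(_ I) fG.
have [M hM] : exists M, forall n, \sum_(k < n) d k x <= M.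
  exists ((fine (G x)) `^ p^-1) => n.
  have : ((S n x `^ p)%:E <= G x)%E.
    apply: lime_ge; first exact: cS.
    by exists n => // m /= nm; exact: ndS.
  rewrite -{1}(fineK fG) lee_fin => /(@ge0_ler_powR _ p^-1 _ _ _ _ _).
  rewrite -powRrM mulfV ?gt_eqF// powRr1//; apply.
  + by rewrite invr_ge0 ltW.
  + by rewrite nnegrE powR_ge0.
  + by rewrite nnegrE fine_ge0.
have cRe : cvgn (fun n => complex.Re (h n x)).
  apply: (@real_series_cvg _ (d^~ x)); last by exists M.
  by move=> n; apply: le_trans (Re_le_normc _); rewrite raddfB.
have cIm : cvgn (fun n => complex.Im (h n x)).
  apply: (@real_series_cvg _ (d^~ x)); last by exists M.
  by move=> n; apply: le_trans (Im_le_normc _); rewrite raddfB.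
have esupE (u : R^nat) : cvgn u -> fine (limn_esup (EFin \o u)) = limn u.
  move=> cu; have h1 : EFin \o u @ \oo --> (limn u)%:E.
    by apply: cvg_EFin => //; exact: nearW.
  rewrite is_cvg_limn_esupE; last by apply/cvg_ex; eexists; exact: h1.
  by rewrite (cvg_lim _ h1).
apply: (@squeeze_cvgr _ _ _ _ (fun=> 0) (fun n =>
   `|complex.Re (h n x) - complex.Re (f x)| + `|complex.Im (h n x) - complex.Im (f x)|)).
- apply: nearW => n; rewrite normc_ge0/=; apply: le_trans (normc_le_ReIm _) _.
  by rewrite !raddfB.
- exact: cvg_cst.
- rewrite -[X in _ --> X]addr0; apply: cvgD.
  + rewrite /= esupE//; apply/norm_cvg0P; rewrite -(subrr (limn (fun n => complex.Re (h n x)))).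
    by apply: cvgB => //; exact: cvg_cst.
  + rewrite /= esupE//; apply/norm_cvg0P; rewrite -(subrr (limn (fun n => complex.Im (h n x)))).
    by apply: cvgB => //; exact: cvg_cst.
Qed.

End Lp_limits.

(** * Affine changes of variable *)

Section affine_change.
Context {R : realType}.
Local Notation mu := (@lebesgue_measure R).

Lemma measurable_affine (e b : R) : measurable_fun setT (fun x : R => e * x + b).
Proof. by apply: measurable_funD => //; exact: measurable_funM. Qed.

Lemma pushforward_measure_ex (phi : R -> R) : measurable_fun setT phi ->
  exists nu : {measure set (measurableTypeR R) -> \bar R},
    forall A, nu A = mu (phi @^-1` A).
Proof.
move=> mphi; unshelve refine (ex_intro _
  (pushforward mu (phi : measurableTypeR R -> measurableTypeR R)
    : {measure set _ -> \bar R}) _).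
  exact: mphi.
by [].
Qed.

Lemma affine_preimage_oc (e b c d : R) : e != 0 ->
  mu ((fun x : R => e * x + b) @^-1` `]c, d]) =
  (if c < d then ((d - c) / `|e|)%:E else 0%E).
Proof.
move=> e0; have := e0; rewrite neq_lt => /orP[eneg|epos].
  have -> : (fun x : R => e * x + b) @^-1` `]c, d]%classic =
      `[(d - b) / e, (c - b) / e[%classic.
    apply/seteqP; split => x /=; rewrite !in_itv/= ler_ndivrMr// ltr_ndivlMr//;
      rewrite [x * e]mulrC; lra.
  rewrite lebesgue_measure_itv/= lte_fin ltr_ndivrMr// divfK//.
  rewrite ltrD2r; case: ifPn => // _; rewrite -EFinB ltr0_norm//; congr EFin.
  by field.
have -> : (fun x : R => e * x + b) @^-1` `]c, d]%classic =
    `](c - b) / e, (d - b) / e]%classic.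
  apply/seteqP; split => x /=; rewrite !in_itv/= ler_pdivlMr// ltr_pdivrMr//;
    rewrite [x * e]mulrC; lra.
rewrite lebesgue_measure_itv/= lte_fin ltr_pdivrMr// divfK//.
rewrite ltrD2r; case: ifPn => // _; rewrite -EFinB gtr0_norm//; congr EFin.
by field.
Qed.

(** Both sides are measures in A, hence determined by their values on half-open
    intervals. *)
Lemma lebesgue_measure_affine (e b : R) (A : set R) : e != 0 -> measurable A ->
  mu A = (`|e|%R%:E * mu ((fun x : R => e * x + b)%R @^-1` A))%E.
Proof.
move=> e0 mA.
have [nu nuE] := pushforward_measure_ex (measurable_affine e b).
have -> : mu ((fun x : R => e * x + b) @^-1` A) = nu A by rewrite nuE.
have e_ge0 : 0 <= `|e| by [].
apply: (@lebesgue_measure_unique R (mscale (NngNum e_ge0) nu)) => //.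
move=> X [[c d] _ <-]; rewrite /mscale/=.
rewrite [X in _ = (_ * X)%E](nuE `]c, d]%classic) affine_preimage_oc//.
rewrite lebesgue_measure_itv/= lte_fin; case: ifPn => _; last by rewrite mule0.
by rewrite -EFinB -EFinM mulrC divfK// normr_eq0.
Qed.

Lemma ge0_integral_affine (e b : R) (G : R -> \bar R) : e != 0 ->
  measurable_fun setT G -> (forall x, (0 <= G x)%E) ->
  (\int[mu]_x G (e * x + b)%R = (`|e|^-1)%R%:E * \int[mu]_x G x)%E.
Proof.
move=> e0 mG G0.
have [nu nuE] := pushforward_measure_ex (measurable_affine e b).
have e_ge0 : 0 <= `|e| by [].
have -> : (\int[mu]_x G x = \int[mscale (NngNum e_ge0) nu]_x G x)%E.
  apply: eq_measure_integral => A mA _.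
  by have := lebesgue_measure_affine b e0 mA; rewrite -nuE.
rewrite ge0_integral_mscale//= muleA -EFinM mulVf ?normr_eq0// mul1e.
have fE : (nu : set (measurableTypeR R) -> \bar R) =
    pushforward mu (fun x : R => e * x + b).
  by apply/funext => A; rewrite nuE.
rewrite fE.
rewrite ge0_integral_pushforward ?preimage_setT//.
exact: measurable_affine.
Qed.

Lemma ae_affine (e b : R) (P : R -> Prop) : e != 0 ->
  {ae mu, forall x, P x} -> {ae mu, forall x, P (e * x + b)}.
Proof.
move=> e0 [Z [mZ Z0 PZ]].
exists ((fun x => e * x + b) @^-1` Z); split.
- by rewrite -[X in measurable X]setTI; exact: measurable_affine.
- have := lebesgue_measure_affine b e0 mZ; rewrite [X in X = _]Z0 => /esym/eqP.
  by rewrite mule_eq0 eqe normr_eq0 (negbTE e0)/= => /eqP.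
- by move=> x /= nP; exact: PZ.
Qed.

Lemma Rintegral_affine (e b : R) (g : R -> R) : e != 0 ->
  mu.-integrable setT (EFin \o g) ->
  \int[mu]_x g (e * x + b) = `|e|^-1 * \int[mu]_x g x.
Proof.
move=> e0 ig; have mg := measurable_int _ ig.
rewrite /Rintegral integralE [in RHS]integralE.
have -> : (\int[mu]_x (fun x => (g (e * x + b)%R)%:E)^\+ x =
    (`|e|^-1)%R%:E * \int[mu]_x (EFin \o g)^\+ x)%E.
  rewrite -(@ge0_integral_affine e b (EFin \o g)^\+%E)//; last exact: (measurable_funepos mg).
  by apply: eq_integral => x _; rewrite ?funeposE ?funenegE.
have -> : (\int[mu]_x (fun x => (g (e * x + b)%R)%:E)^\- x =
    (`|e|^-1)%R%:E * \int[mu]_x (EFin \o g)^\- x)%E.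
  rewrite -(@ge0_integral_affine e b (EFin \o g)^\-%E)//; last exact: (measurable_funeneg mg).
  by apply: eq_integral => x _; rewrite ?funeposE ?funenegE.
have fp := integrable_pos_fin_num measurableT ig.
have fn := integrable_neg_fin_num measurableT ig.
rewrite -muleBr//; last by rewrite fin_num_adde_defl ?fin_numN.
by rewrite fineM// fin_numB fp.
Qed.

End affine_change.

(** * Integrals of complex functions *)

Section complex_integrals.
Context {R : realType}.
Local Notation mu := (@lebesgue_measure R).
Implicit Types (f g : R -> R[i]).

Definition cintegrable f := mu.-integrable setT (fun x => (complex.Re (f x))%:E) /\
  mu.-integrable setT (fun x => (complex.Im (f x))%:E).

Lemma cintegrable_measurable f : cintegrable f -> complex_measurable f.
Proof.
by move=> [/measurable_int/measurable_EFinP fr /measurable_int/measurable_EFinP fi].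
Qed.

Lemma cintegrable_le f (g : R -> R) : complex_measurable f ->
  mu.-integrable setT (EFin \o g) ->
  {ae mu, forall x, Normc.normc (f x) <= g x} -> cintegrable f.
Proof.
move=> [fr fi] ig fg.
have mg := measurable_int _ ig.
have gen (h : R -> R) : measurable_fun setT h ->
    (forall x, `|h x| <= Normc.normc (f x)) -> mu.-integrable setT (EFin \o h).
  move=> mh hf; apply/integrableP; split; first exact/measurable_EFinP.
  have /integrableP[_] := ig; apply: le_lt_trans.
  apply: ae_ge0_le_integral => //.
  - by apply: measurableT_comp => //; exact/measurable_EFinP.
  - exact: measurableT_comp.
  - apply: ae_imp fg => x fg _ /=; rewrite lee_fin.
    exact: le_trans (hf x) (le_trans fg (ler_norm _)).
split; apply: gen => // x; [exact: Re_le_normc|exact: Im_le_normc].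
Qed.

Lemma integrable_normc f : cintegrable f ->
  mu.-integrable setT (fun x => (Normc.normc (f x))%:E).
Proof.
move=> cf; have mf := cintegrable_measurable cf; case: cf => fr fi.
apply: (@le_integrable _ _ _ mu setT measurableT _
   (fun x => `|(complex.Re (f x))%:E| + `|(complex.Im (f x))%:E|)%E).
- by apply/measurable_EFinP; exact: complex_measurable_normc.
- move=> x _ /=; rewrite lee_fin ger0_norm ?normc_ge0// ger0_norm ?addr_ge0//.
  exact: normc_le_ReIm.
- by apply: integrableD => //; exact: integrable_abse.
Qed.

Lemma cintegrable_bounded_mul (C : R) f g : complex_measurable g ->
  {ae mu, forall x, Normc.normc (g x) <= C} -> cintegrable f ->
  cintegrable (fun x => g x * f x).
Proof.
move=> mg gC cf; apply: (@cintegrable_le _ (fun x => C * Normc.normc (f x))).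
- by apply: complex_measurableM => //; exact: cintegrable_measurable.
- exact: (integrableZl measurableT C (integrable_normc cf)).
- apply: ae_imp gC => x gC; rewrite Normc.normcM ler_wpM2r// normc_ge0//.
Qed.

Lemma cintegrable_expi (h : R -> R) f : measurable_fun setT h -> cintegrable f ->
  cintegrable (fun x => expi (h x) * f x).
Proof.
move=> mh; apply: (@cintegrable_bounded_mul 1); first exact: complex_measurable_expi.
by apply: ae_all => x; rewrite normc_expi.
Qed.

Lemma cintegrable_lin (a : R[i]) f g : cintegrable f -> cintegrable g ->
  cintegrable (fun x => a * f x + g x).
Proof.
move=> cf cg; apply: (@cintegrable_le _
    (fun x => Normc.normc a * Normc.normc (f x) + Normc.normc (g x))).
- by apply: complex_measurable_lin; exact: cintegrable_measurable.
- exact: (integrableD measurableT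
    (integrableZl measurableT _ (integrable_normc cf)) (integrable_normc cg)).
- by apply: ae_all => x; apply: le_trans (le_normcD _ _) _; rewrite Normc.normcM.
Qed.

Lemma complex_integral_lin (a : R[i]) f g : cintegrable f -> cintegrable g ->
  complex_integral (fun x => a * f x + g x) =
  a * complex_integral f + complex_integral g.
Proof.
move=> [fr fi] [gr gi].
have Zl (r : R) (h : R -> R) : mu.-integrable setT (EFin \o h) ->
    mu.-integrable setT (EFin \o (fun x => r * h x)).
  by move=> ih; exact: (integrableZl measurableT r ih).
apply/eqP; rewrite eq_complex Re_addc Im_addc Re_mulc Im_mulc /=; apply/andP; split; apply/eqP.
- have -> : (fun x => complex.Re (a * f x + g x)) = (fun x =>
      (complex.Re a * complex.Re (f x) - complex.Im a * complex.Im (f x)) + complex.Re (g x)).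
    by apply/funext => x; rewrite Re_addc Re_mulc.
  rewrite RintegralD//; last first.
    exact: (integrableB measurableT (Zl _ _ fr) (Zl _ _ fi)).
  by rewrite RintegralB ?RintegralZl//; exact: Zl.
- have -> : (fun x => complex.Im (a * f x + g x)) = (fun x =>
      (complex.Re a * complex.Im (f x) + complex.Im a * complex.Re (f x)) + complex.Im (g x)).
    by apply/funext => x; rewrite Im_addc Im_mulc.
  rewrite RintegralD//; last first.
    exact: (integrableD measurableT (Zl _ _ fi) (Zl _ _ fr)).
  by rewrite RintegralD ?RintegralZl//; exact: Zl.
Qed.

Lemma complex_integral0 : complex_integral (fun=> 0 : R[i]) = 0.
Proof. by rewrite /complex_integral /Rintegral /= integral0. Qed.

Lemma cintegrable0 : cintegrable (fun=> 0 : R[i]).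
Proof. by split; exact: integrable0. Qed.

Lemma complex_integralZ (a : R[i]) f : cintegrable f ->
  complex_integral (fun x => a * f x) = a * complex_integral f.
Proof.
move=> cf; have := complex_integral_lin a cf cintegrable0.
by rewrite complex_integral0 addr0; under [X in complex_integral X]eq_fun do rewrite addr0.
Qed.

(** The factor 2 is the cost of treating real and imaginary parts separately; the
    bound only serves to show decay, where constants do not matter. *)
Lemma normc_complex_integral f : cintegrable f ->
  Normc.normc (complex_integral f) <= 2 * \int[mu]_x Normc.normc (f x).
Proof.
move=> cf; have [fr fi] := cf; have inf := integrable_normc cf.
apply: le_trans (normc_le_ReIm _) _ => /=; rewrite mulr2n mulrDl mul1r lerD//.
  apply: le_trans (le_normr_Rintegral _ fr) _ => //; apply: le_Rintegral => //.
    exact: integrable_norm.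
  by move=> x _; exact: Re_le_normc.
apply: le_trans (le_normr_Rintegral _ fi) _ => //; apply: le_Rintegral => //.
  exact: integrable_norm.
by move=> x _; exact: Im_le_normc.
Qed.

Lemma complex_integral_affine (e b : R) f : e != 0 -> cintegrable f ->
  complex_integral (fun x => f (e * x + b)) = (`|e|^-1)%:C * complex_integral f.
Proof.
move=> e0 [fr fi]; apply/eqP; rewrite eq_complex Re_mulc Im_mulc /= !mul0r subr0 addr0.
rewrite (@Rintegral_affine _ e b (fun x => complex.Re (f x)))//.
by rewrite (@Rintegral_affine _ e b (fun x => complex.Im (f x)))// !eqxx.
Qed.

Lemma complex_integral_dominated (u : nat -> R -> R[i]) f (g : R -> R) :
  (forall n, complex_measurable (u n)) -> complex_measurable f ->
  mu.-integrable setT (EFin \o g) ->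
  {ae mu, forall x, (fun n => Normc.normc (u n x - f x)) @ \oo --> (0 : R)} ->
  {ae mu, forall x, forall n, Normc.normc (u n x) <= g x} ->
  (fun n => Normc.normc (complex_integral (u n) - complex_integral f)) @ \oo --> (0 : R).
Proof.
move=> mu_ mf ig uf ug.
have real_dct (part : R[i] -> R) : (forall z w, part (z - w) = part z - part w) ->
    (forall z, `|part z| <= Normc.normc z) ->
    (forall h : R -> R[i], complex_measurable h -> measurable_fun setT (fun x => part (h x))) ->
    (fun n => `|\int[mu]_x part (u n x) - \int[mu]_x part (f x)|) @ \oo --> (0 : R).
  move=> partB part_le mpart.
  have [||||ipf _ h] := @dominated_convergence _ _ _ mu setT measurableT
    (fun n x => (part (u n x))%:E) (fun x => (part (f x))%:E) (EFin \o g) _ _ _ ig.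
  - by move=> n; apply/measurable_EFinP; exact: mpart.
  - by apply/measurable_EFinP; exact: mpart.
  - apply: ae_imp uf => x uf _; apply: cvg_EFin; first exact: nearW.
    apply/cvgrPdist_le => /= e e0; move/cvgrPdist_le : uf => /(_ _ e0).
    apply: filterS => n; rewrite sub0r normrN ger0_norm ?normc_ge0//.
    by rewrite normc_sub -partB; apply: le_trans.
  - apply: ae_imp ug => x ug n _; rewrite /= lee_fin; exact: le_trans (part_le _) (ug n).
  apply/norm_cvg0P; rewrite -(subrr (\int[mu]_x part (f x))).
  apply: cvgB; last exact: cvg_cst.
  apply: fine_cvg; rewrite fineK; first exact: h.
  exact: integrable_fin_num.
apply: (@squeeze_cvgr _ _ _ _ (fun=> 0) (fun n =>
   `|\int[mu]_x complex.Re (u n x) - \int[mu]_x complex.Re (f x)|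
   + `|\int[mu]_x complex.Im (u n x) - \int[mu]_x complex.Im (f x)|)).
- apply: nearW => n; rewrite normc_ge0 andTb.
  by apply: le_trans (normc_le_ReIm _) _; rewrite !raddfB.
- exact: cvg_cst.
- rewrite -[X in _ --> X]addr0; apply: cvgD; apply: real_dct => //.
  + by move=> z w; rewrite raddfB.
  + exact: Re_le_normc.
  + by move=> h [].
  + by move=> z w; rewrite raddfB.
  + exact: Im_le_normc.
  + by move=> h [].
Qed.

(** The integral is continuous in x, by dominated convergence with bound |f|.  The
    statement covers both the Fourier transform and multiplier operators. *)
Lemma complex_measurable_oscillatory (c : R) f : cintegrable f ->
  complex_measurable (fun x => complex_integral (fun y => expi (c * x * y) * f y)).
Proof.
move=> cf.
have cvgF (w : R^nat) (x : R) : w @ \oo --> x ->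
    (fun n => Normc.normc (complex_integral (fun y => expi (c * w n * y) * f y) -
      complex_integral (fun y => expi (c * x * y) * f y))) @ \oo --> (0 : R).
  move=> wx.
  have mE (z : R) : complex_measurable (fun y => expi (c * z * y) * f y).
    apply: complex_measurableM; last exact: cintegrable_measurable.
    by apply: complex_measurable_expi; exact: measurable_funM.
  apply: (@complex_integral_dominated _ _ (fun y => Normc.normc (f y))) => //.
  - exact: integrable_normc.
  - apply: ae_all => y.
    apply: (@squeeze_cvgr _ _ _ _ (fun=> 0) (fun n =>
       (`|cos (c * w n * y) - cos (c * x * y)| +
        `|sin (c * w n * y) - sin (c * x * y)|) * Normc.normc (f y))).
    + apply: nearW => n; rewrite normc_ge0 andTb -mulrBl Normc.normcM.
      by rewrite ler_wpM2r ?normc_ge0//; exact: normc_le_ReIm.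
    + exact: cvg_cst.
    + have cw : (fun n => c * w n * y) @ \oo --> c * x * y.
        by apply: cvgMl; apply: cvgMr.
      rewrite -[X in _ --> X](mul0r (Normc.normc (f y))); apply: cvgMl.
      rewrite -[X in _ --> X]addr0; apply: cvgD.
      * apply/norm_cvg0P; rewrite -(subrr (cos (c * x * y))).
        apply: cvgB; last exact: cvg_cst.
        by apply: continuous_cvg => //; exact: continuous_cos.
      * apply/norm_cvg0P; rewrite -(subrr (sin (c * x * y))).
        apply: cvgB; last exact: cvg_cst.
        by apply: continuous_cvg => //; exact: continuous_sin.
  - by apply: ae_all => y n; rewrite Normc.normcM normc_expi mul1r.
pose F x := complex_integral (fun y => expi (c * x * y) * f y).
have part_meas (part : R[i] -> R) :
    (forall z w, `|part z - part w| <= Normc.normc (z - w)) ->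
    measurable_fun setT (fun x => part (F x)).
  move=> partB; apply: continuous_measurable_fun => x.
  apply/(@cvg_nbhsP _ R^o) => w wx.
  apply/cvgrPdist_le => e e0; have /cvgrPdist_le/(_ _ e0) := cvgF _ _ wx.
  apply: filterS => n; rewrite sub0r normrN ger0_norm ?normc_ge0// normc_sub.
  by apply: le_trans; exact: partB.
split; apply: part_meas => z w.
- by rewrite -raddfB; exact: Re_le_normc.
- by rewrite -raddfB; exact: Im_le_normc.
Qed.

End complex_integrals.

(** * Fourier transforms of test functions and multiplier operators *)

Section fourier_test.
Context {R : realType}.
Local Notation mu := (@lebesgue_measure R).
Implicit Types (f g : R -> R[i]).

Lemma integrable_indic_itv (M B : R) :
  mu.-integrable setT (EFin \o (fun x : R => M * \1_`[-B, B] x)).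
Proof.
have h : mu.-integrable setT (EFin \o (\1_`[-B, B] : R -> R)); last first.
  exact: (integrableZl measurableT M h).
apply/integrableP; split; first exact/measurable_EFinP/measurable_indic.
under eq_integral do rewrite gee0_abs ?lee_fin//.
rewrite integral_indic// setIT [X in (X < _)%E]lebesgue_measure_itv/=.
by case: ifPn => // _; rewrite -EFinB ltry.
Qed.

Lemma Cc_infty_bounded f : Cc_infty f -> exists M B : R,
  0 <= M /\ forall x, Normc.normc (f x) <= M * \1_`[-B, B] x.
Proof.
move=> /Cc_inftyP[fr fi [B hB]].
have bnd (h : R -> R) : smooth h -> exists2 M : R, 0 <= M & forall x, `|x| <= B -> `|h x| <= M.
  move=> sh.
  have := @compact_bounded _ R^o (h @` `[-B, B]).
  case.
    apply: continuous_compact; last exact: segment_compact.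
    by apply: continuous_subspaceT; exact: smooth_continuous sh.
  move=> M [_ hM]; exists (`|M| + 1); first by rewrite addr_ge0.
  move=> x xB; apply: (hM (`|M| + 1)); first by rewrite (le_lt_trans (ler_norm _))// ltrDl.
  by exists x => //=; rewrite in_itv/= -ler_norml.
have [M M0 hM] := bnd _ fr; have [K K0 hK] := bnd _ fi.
exists (M + K), B; split; first exact: addr_ge0.
move=> x; rewrite indicE; case: (leP `|x| B) => xB.
  rewrite mem_set ?mulr1; last by rewrite /= in_itv/= -ler_norml.
  by apply: le_trans (normc_le_ReIm _) _; rewrite lerD ?hM ?hK.
rewrite hB// Normc.normc0 mulr_ge0// addr_ge0//.
Qed.

Lemma Cc_infty_cintegrable f : Cc_infty f -> cintegrable f.
Proof.
move=> Cf; have [M [B [_ fM]]] := Cc_infty_bounded Cf.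
apply: cintegrable_le (integrable_indic_itv M B) _; first exact: complex_measurable_Cc.
exact: ae_all.
Qed.

Lemma Cc_infty_Lfun (p : R) f : 1 <= p -> Cc_infty f -> complex_Lfun p%:E f.
Proof.
move=> p1 Cf; have p0 : 0 < p by exact: lt_le_trans p1.
have [M [B [M0 fM]]] := Cc_infty_bounded Cf.
split; first exact: complex_measurable_Cc.
apply/(complex_Lnorm_lty p1).
have /integrableP[_] := integrable_indic_itv (M `^ p) B; apply: le_lt_trans.
apply: ge0_le_integral => //.
- by move=> x _; rewrite lee_fin powR_ge0.
- by apply: complex_measurable_pow; exact: complex_measurable_Cc.
- apply: measurableT_comp => //; apply/measurable_EFinP.
  by apply: measurable_funM => //; exact: measurable_indic.
move=> x _ /=; rewrite lee_fin; apply: le_trans (ler_norm _).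
apply: (@le_trans _ _ ((M * \1_`[-B, B] x) `^ p)).
  apply: ge0_ler_powR (fM x); [exact: ltW|by rewrite nnegrE normc_ge0|].
  by rewrite nnegrE mulr_ge0.
rewrite indicE; case: (_ \in _); first by rewrite !mulr1.
by rewrite !mulr0 powR0// gt_eqF.
Qed.

(** The fundamental theorem of calculus on an interval whose end points lie outside
    the support of u. *)
Lemma Rintegral_derive1 (u : R -> R) (B : R) : smooth u ->
  (forall x, B < `|x| -> u x = 0) -> \int[mu]_x derive1 u x = 0.
Proof.
move=> su uB.
(* beyond |B| both u and its derivative vanish, also at the end points *)
pose C := `|B| + 1.
have C0 : 0 < C by rewrite ltr_wpDl.
have BC : B < C by rewrite (le_lt_trans (ler_norm _))// ltrDl.
have du0 x : C < `|x| -> derive1 u x = 0.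
  move=> Cx; apply: derive1_near0; apply/nbhs_ballP; exists (`|x| - B) => /=.
    by rewrite subr_gt0 (lt_trans BC).
  move=> z; rewrite /ball/= => xz; apply: uB.
  by move: (le_lt_trans (lerB_dist x z) xz); rewrite ltrBlDr; lra.
have -> : \int[mu]_x derive1 u x = \int[mu]_(x in `[-C, C]) derive1 u x.
  rewrite [RHS]Rintegral_mkcond; congr Rintegral; apply/funext => x.
  rewrite patchE; case: ifPn => // /negP xC; apply: du0.
  rewrite ltNge; apply/negP => xC'; apply: xC.
  by rewrite inE/= in_itv/= -ler_norml.
rewrite /Rintegral (@continuous_FTC2 _ (derive1 u) u)/=.
- by rewrite !uB ?subrr// ?normrN ger0_norm// ltW.
- by rewrite gtrN.
- by apply: continuous_subspaceT; exact: smooth_continuous (smooth_derive1 su).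
- split.
  + by move=> x _; exact: (su 0%N).
  + by apply: cvg_at_right_filter; exact: smooth_continuous su _.
  + by apply: cvg_at_left_filter; exact: smooth_continuous su _.
- by [].
Qed.

Lemma complex_integral_cderive1 f : Cc_infty f -> complex_integral (cderive1 f) = 0.
Proof.
move=> /Cc_inftyP[fr fi [B hB]].
by rewrite /complex_integral /cderive1 /= !(@Rintegral_derive1 _ B)// => x /hB ->.
Qed.

Lemma cderive1_modulate (a : R) f x : Cc_infty f ->
  cderive1 (modulate a 1 f) x =
  (0 +i* (2 * pi * a)) * modulate a 1 f x + expi (2 * pi * a * x) * cderive1 f x.
Proof.
move=> [fr fi _]; pose c := 2 * pi * a.
have dlin : is_derive x 1 (fun x : R => c * x) c.
  by apply: is_derive_eq; rewrite /GRing.scale/=; lra.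
have dcos : is_derive x 1 (fun x : R => cos (c * x)) (- sin (c * x) * c).
  exact: (@is_derive1_comp _ cos (fun x : R => c * x) x _ _ (is_derive_cos _) dlin).
have dsin : is_derive x 1 (fun x : R => sin (c * x)) (cos (c * x) * c).
  exact: (@is_derive1_comp _ sin (fun x : R => c * x) x _ _ (is_derive_sin _) dlin).
have dre := smooth_is_derive x fr; have dim := smooth_is_derive x fi.
have mRe y : complex.Re (modulate a 1 f y) =
    cos (c * y) * complex.Re (f y) - sin (c * y) * complex.Im (f y).
  by rewrite Re_mulc /= mul1r.
have mIm y : complex.Im (modulate a 1 f y) =
    cos (c * y) * complex.Im (f y) + sin (c * y) * complex.Re (f y).
  by rewrite Im_mulc /= mul1r.
have h1 := is_deriveB (is_deriveM dcos dre) (is_deriveM dsin dim).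
have h2 := is_deriveD (is_deriveM dcos dim) (is_deriveM dsin dre).
have := mIm x; have := mRe x; move: (modulate a 1 f x) => Mx mRex mImx.
apply/eqP; rewrite eq_complex Re_addc Im_addc !Re_mulc !Im_mulc mRex mImx.
rewrite [complex.Re (cderive1 (modulate _ _ _) _)]/= [complex.Im (cderive1 (modulate _ _ _) _)]/=.
rewrite (funext mRe) (funext mIm).
apply/andP; split; apply/eqP => /=.
- rewrite derive1E; apply: (@derive_val _ _ _ _ _ _ _ _).
  apply: (is_derive_eq h1); rewrite /GRing.scale/= -/c; ring.
- rewrite derive1E; apply: (@derive_val _ _ _ _ _ _ _ _).
  apply: (is_derive_eq h2); rewrite /GRing.scale/= -/c; ring.
Qed.

(** A value of the Fourier transform is the integral of another test function,
    which reduces the Fourier side to integrals of test functions. *)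
Lemma fourierE f y : fourier f y = complex_integral (modulate (- y) 1 f).
Proof.
rewrite /fourier; congr complex_integral; apply/funext => x.
rewrite /modulate mul1r; congr (expi _ * _); ring.
Qed.

(** Integration by parts: the derivative of the modulated test function integrates
    to 0. *)
Lemma fourier_cderive1 f y : Cc_infty f ->
  fourier (cderive1 f) y = (0 +i* (2 * pi * y)) * fourier f y.
Proof.
move=> Cf.
have Cm (h : R -> R[i]) : Cc_infty h -> Cc_infty (modulate (- y) 1 h).
  by apply: Cc_infty_modulate; exact: oner_neq0.
have := complex_integral_cderive1 (Cm _ Cf).
have -> : cderive1 (modulate (- y) 1 f) = (fun x =>
    (0 +i* (2 * pi * - y)) * modulate (- y) 1 f x + modulate (- y) 1 (cderive1 f) x).
  by apply/funext => x; rewrite cderive1_modulate// /modulate mul1r.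
rewrite complex_integral_lin; last 2 first.
  by apply: Cc_infty_cintegrable; exact: Cm.
  by apply: Cc_infty_cintegrable; apply: Cm; exact: Cc_infty_cderive1.
rewrite -!fourierE addrC => /eqP; rewrite addr_eq0 => /eqP ->.
rewrite -mulNr; congr (_ * _); apply/eqP; rewrite eq_complex/= oppr0 eqxx/=.
by rewrite mulrN opprK.
Qed.

Lemma normc_fourier_le f y : Cc_infty f ->
  Normc.normc (fourier f y) <= 2 * \int[mu]_x Normc.normc (f x).
Proof.
move=> Cf; rewrite fourierE; apply: le_trans (normc_complex_integral _) _.
  apply: Cc_infty_cintegrable; apply: Cc_infty_modulate => //; exact: oner_neq0.
rewrite le_eqVlt; apply/orP; left; apply/eqP; congr (_ * _); congr Rintegral.
by apply/funext => x; rewrite /modulate Normc.normcM normc_expi !mul1r.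
Qed.

Lemma integrable_oneDsqrV : mu.-integrable setT (fun x : R => ((oneDsqr x)^-1)%:E).
Proof.
have pos (x : R) : 0 <= (oneDsqr x)^-1 by rewrite invr_ge0 (le_trans ler01).
apply/integrableP; split.
  by apply/measurable_EFinP; apply: continuous_measurable_fun; exact: continuous_oneDsqrV.
under eq_integral do rewrite gee0_abs ?lee_fin//.
rewrite ge0_symfun_integralT//.
- rewrite (_ : [set x | 0 <= x] = `[0%R, +oo[%classic); last first.
    by apply/seteqP; split => x /=; rewrite in_itv/= andbT.
  by rewrite integral0y_oneDsqr -EFinM ltry.
- exact: continuous_oneDsqrV.
- by move=> x; rewrite /= /oneDsqr sqrrN.
Qed.

Lemma fourier_measurable f : cintegrable f -> complex_measurable (fourier f).
Proof.
move=> cf; have := complex_measurable_oscillatory (- (2 * pi)) cf.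
congr complex_measurable; apply/funext => y; rewrite /fourier.
congr complex_integral; apply/funext => x; congr (expi _ * _); ring.
Qed.

(** Two integrations by parts bound (1 + y^2) |fourier f y|. *)
Lemma Cc_infty_fourier_cintegrable f : Cc_infty f -> cintegrable (fourier f).
Proof.
move=> Cf.
have Cf1 := Cc_infty_cderive1 Cf; have Cf2 := Cc_infty_cderive1 Cf1.
pose K0 := 2 * \int[mu]_x Normc.normc (f x).
pose K2 := 2 * \int[mu]_x Normc.normc (cderive1 (cderive1 f) x).
apply: (@cintegrable_le _ _ (fun y => (K0 + K2) * (oneDsqr y)^-1)).
- by apply: fourier_measurable; exact: Cc_infty_cintegrable.
- exact: (integrableZl measurableT _ integrable_oneDsqrV).
apply: ae_all => y.
have h0 := normc_fourier_le y Cf; have h2 := normc_fourier_le y Cf2.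
rewrite -/K0 in h0; rewrite -/K2 !fourier_cderive1// mulrA Normc.normcM in h2.
have nyy : Normc.normc ((0 +i* (2 * pi * y)) * (0 +i* (2 * pi * y))) = (2 * pi * y) ^+ 2.
  by rewrite Normc.normcM /= expr0n add0r sqrtr_sqr -expr2 real_normK ?num_real.
rewrite nyy in h2.
have o0 : 0 < oneDsqr y by rewrite (lt_le_trans ltr01).
rewrite ler_pdivlMr// /oneDsqr mulrDr mulr1 lerD//.
apply: le_trans h2; rewrite mulrC ler_wpM2r ?normc_ge0//.
(* here (2 pi)^2 >= 1 is used *)
rewrite exprMn ler_peMl ?sqr_ge0// -[leLHS](expr1n _ 2) lerXn2r ?nnegrE ?mulr_ge0 ?pi_ge0//.
have := @pi_ge2 R; lra.
Qed.

Lemma cintegrableZ (a : R[i]) f : cintegrable f -> cintegrable (fun x => a * f x).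
Proof.
move=> cf; have := cintegrable_lin a cf cintegrable0.
by under [X in cintegrable X -> _]eq_fun do rewrite addr0.
Qed.

Lemma fourier_lin (a : R[i]) f g y : Cc_infty f -> Cc_infty g ->
  fourier (fun x => a * f x + g x) y = a * fourier f y + fourier g y.
Proof.
move=> Cf Cg; rewrite !fourierE.
have Cm (h : R -> R[i]) : Cc_infty h -> cintegrable (modulate (- y) 1 h).
  by move=> Ch; apply: Cc_infty_cintegrable; apply: Cc_infty_modulate => //; exact: oner_neq0.
rewrite -complex_integral_lin; [|exact: Cm..].
congr complex_integral; apply/funext => x; rewrite /modulate; ring.
Qed.

Lemma fourier_modulate (a e : R) f y : e != 0 -> Cc_infty f ->
  fourier (modulate a e f) y = (`|e|^-1)%:C * fourier f (e^-1 * y + - (a / e)).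
Proof.
move=> e0 Cf; rewrite !fourierE.
set m := modulate (- (e^-1 * y + - (a / e))) 1 f.
rewrite -(@complex_integral_affine _ e 0 m e0); last first.
  by apply: Cc_infty_cintegrable; apply: Cc_infty_modulate => //; exact: oner_neq0.
congr complex_integral; apply/funext => x.
rewrite /m /modulate mulrA -expiD !mul1r addr0; congr (expi _ * _).
by field.
Qed.

Definition ess_bounded (M : R -> R[i]) :=
  complex_measurable M /\ exists C : R, {ae mu, forall x, Normc.normc (M x) <= C}.

Lemma multiplier_integrable (M : R -> R[i]) f : ess_bounded M -> Cc_infty f ->
  cintegrable (fun y => M y * fourier f y).
Proof.
move=> [mM [C MC]] Cf; apply: cintegrable_bounded_mul mM MC _.
exact: Cc_infty_fourier_cintegrable.
Qed.

Lemma multiplier_op_measurable (M : R -> R[i]) f : ess_bounded M -> Cc_infty f ->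
  complex_measurable (multiplier_op M f).
Proof. by move=> bM Cf; apply: complex_measurable_oscillatory; exact: multiplier_integrable. Qed.

Lemma multiplier_op_lin (M : R -> R[i]) (a : R[i]) f g x : ess_bounded M ->
  Cc_infty f -> Cc_infty g ->
  multiplier_op M (fun x => a * f x + g x) x = a * multiplier_op M f x + multiplier_op M g x.
Proof.
move=> bM Cf Cg; rewrite /multiplier_op -complex_integral_lin; last 2 first.
- by apply: cintegrable_expi; [exact: measurable_funM|exact: multiplier_integrable].
- by apply: cintegrable_expi; [exact: measurable_funM|exact: multiplier_integrable].
congr complex_integral; apply/funext => y; rewrite fourier_lin//; ring.
Qed.

Lemma ess_bounded_affine (M : R -> R[i]) (a e : R) : e != 0 -> ess_bounded M ->
  ess_bounded (fun u => M (e * u + a)).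
Proof.
move=> e0 [mM [C MC]]; split; first exact: complex_measurable_comp (measurable_affine _ _) mM.
by exists C; exact: ae_affine e0 MC.
Qed.

(** The substitution y = e u + a on the frequency side: rescaling the multiplier
    amounts to conjugating the operator by [modulate], which multiplies all L^p
    norms by the same factor. *)
Lemma multiplier_op_modulate (M : R -> R[i]) (a e : R) f x : e != 0 ->
  ess_bounded M -> Cc_infty f ->
  multiplier_op M (modulate a e f) x =
  modulate a e (multiplier_op (fun u => M (e * u + a)) f) x.
Proof.
move=> e0 bM Cf.
(* the integrand on the frequency side after the substitution y = e u + a *)
pose H u := expi (2 * pi * x * (e * u + a)) * (M (e * u + a) * fourier f u).
have cMf := multiplier_integrable (ess_bounded_affine a e0 bM) Cf.
have cH : cintegrable H.
  apply: cintegrable_expi cMf; apply: measurable_funM => //.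
  exact: measurable_affine.
have Ve0 : e^-1 != 0 by rewrite invr_eq0.
transitivity (complex_integral (fun y => (fun u => (`|e|^-1)%:C * H u)
    (e^-1 * y + - (a / e)))).
  congr complex_integral; apply/funext => y; rewrite fourier_modulate// /H.
  have -> : e * (e^-1 * y - a / e) + a = y by field.
  ring.
rewrite (@complex_integral_affine _ _ _ (fun u => (`|e|^-1)%:C * H u) Ve0);
  last exact: cintegrableZ.
rewrite complex_integralZ// mulrA -rmorphM normfV invrK mulfV ?normr_eq0// mul1r.
rewrite /modulate /multiplier_op -complex_integralZ; last first.
  by apply: cintegrable_expi => //; exact: measurable_funM.
congr complex_integral; apply/funext => u; rewrite /H [RHS]mulrA -expiD.
by congr (expi _ * _); ring.
Qed.

End fourier_test.

(** * Density of test functions in L^p *)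

Section density.
Context {R : realType}.
Variable p : R.
Hypothesis p1 : 1 <= p.
Local Notation mu := (@lebesgue_measure R).
Implicit Types (f g : R -> R[i]).
Local Notation N f := (complex_Lnorm p%:E f%R).

Let p0 : 0 < p. Proof. exact: lt_le_trans p1. Qed.

Definition approximable f := complex_Lfun p%:E f /\
  forall e : R, 0 < e -> exists2 g, Cc_infty g & (N (fun x => f x - g x) <= e%:E)%E.

Lemma approximable_lin (a : R[i]) f g : approximable f -> approximable g ->
  approximable (fun x => a * f x + g x).
Proof.
move=> [Lf af] [Lg ag]; split; first exact: complex_Lfun_lin.
move=> e e0; pose d := e / (Normc.normc a + 1).
have a1 : 0 < Normc.normc a + 1 by rewrite ltr_wpDl ?normc_ge0.
have d0 : 0 < d by rewrite divr_gt0.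
have [u Cu fu] := af _ d0; have [v Cv gv] := ag _ d0.
exists (fun x => a * u x + v x); first exact: Cc_infty_lin.
have -> : (fun x => a * f x + g x - (a * u x + v x)) =
    (fun x => a * (f x - u x) + (g x - v x)) by apply/funext => x; ring.
have mfu : complex_measurable (fun x => f x - u x).
  by apply: complex_measurableB; [case: Lf|exact: complex_measurable_Cc].
have mgv : complex_measurable (fun x => g x - v x).
  by apply: complex_measurableB; [case: Lg|exact: complex_measurable_Cc].
apply: le_trans (complex_LnormD p1 _ mgv) _.
  by apply: complex_measurableM => //; exact: complex_measurable_cst.
rewrite complex_LnormZ//.
apply: (@le_trans _ _ ((Normc.normc a)%:E * d%:E + d%:E)%E).
  by apply: leeD => //; apply: lee_wpmul2l => //; rewrite lee_fin normc_ge0.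
rewrite -EFinM -EFinD lee_fin [leLHS](_ : _ = e)// /d.
by field; rewrite gt_eqF.
Qed.

Lemma approximable_lim f : complex_Lfun p%:E f ->
  (forall e : R, 0 < e -> exists2 g, approximable g & (N (fun x => f x - g x)%R <= e%:E)%E) ->
  approximable f.
Proof.
move=> Lf af; split => // e e0; have e20 : 0 < e / 2 by rewrite divr_gt0.
have [g [Lg ag] fg] := af _ e20; have [h Ch gh] := ag _ e20.
exists h => //.
have -> : (fun x => f x - h x) = (fun x => (f x - g x) + (g x - h x)).
  by apply/funext => x; rewrite addrA subrK.
apply: le_trans (complex_LnormD p1 _ _) _.
- by apply: complex_measurableB; [case: Lf|case: Lg].
- by apply: complex_measurableB; [case: Lg|exact: complex_measurable_Cc].
by rewrite [leRHS](_ : _ = (e / 2)%:E + (e / 2)%:E)%E ?leeD// -EFinD -splitr.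
Qed.

(** Dominated pointwise limits lead from intervals to measurable sets, from simple
    functions to nonnegative ones, and so to all of L^p. *)
Lemma approximable_dominated f g (u : nat -> R -> R[i]) :
  complex_measurable f -> complex_Lfun p%:E g ->
  (forall n, approximable (u n)) ->
  (forall n x, Normc.normc (f x - u n x) <= Normc.normc (g x)) ->
  (forall x, Normc.normc (f x) <= Normc.normc (g x)) ->
  (forall x, (fun n => Normc.normc (f x - u n x)) @ \oo --> (0 : R)) ->
  approximable f.
Proof.
move=> mf Lg au fug fg fu.
have Lf : complex_Lfun p%:E f.
  split => //; case: Lg => mg; apply: le_lt_trans.
  by apply: complex_Lnorm_le_ae => //; exact: ae_all.
apply: approximable_lim => // e e0.
have [|n _ /(_ n (leqnn n)) h] := @complex_Lnorm_dominated _ p p1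
  (fun n x => f x - u n x) g _ Lg fu fug e e0.
  by move=> n; apply: complex_measurableB => //; case: (au n) => -[].
by exists (u n).
Qed.

Definition cindic (A : set R) (x : R) : R[i] := (\1_A x : R)%:C.

Lemma normc_cindic A x : Normc.normc (cindic A x) = \1_A x.
Proof. by rewrite normc_real ger0_norm. Qed.

Lemma complex_measurable_cindic A : measurable A -> complex_measurable (cindic A).
Proof. by move=> mA; apply: complex_measurable_real; exact: measurable_indic. Qed.

Lemma cindic_Lfun (a b : R) : complex_Lfun p%:E (cindic `]a, b[).
Proof.
split; first exact: complex_measurable_cindic.
apply/(complex_Lnorm_lty p1).
have -> : (fun x => (Normc.normc (cindic `]a, b[ x) `^ p)%:E) =
    EFin \o (\1_`]a, b[ : R -> R).
  apply/funext => x; rewrite normc_cindic /= !indicE; case: (_ \in _).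
    by rewrite mulr1n powR1.
  by rewrite mulr0n powR0// gt_eqF.
rewrite integral_indic// setIT [X in (X < _)%E]lebesgue_measure_itv/=.
by case: ifPn => // _; rewrite -EFinB ltry.
Qed.

Lemma approximable_itv (a b : R) : approximable (cindic `]a, b[).
Proof.
apply: (@approximable_dominated _ (cindic `]a, b[) (fun n => smooth_bump a b n.+1%:R)).
- exact: complex_measurable_cindic.
- exact: cindic_Lfun.
- move=> n; have Cb : Cc_infty (smooth_bump a b n.+1%:R) by exact: Cc_infty_smooth_bump.
  split; first exact: Cc_infty_Lfun.
  move=> e e0; exists (smooth_bump a b n.+1%:R) => //.
  have -> : (fun x => smooth_bump a b n.+1%:R x - smooth_bump a b n.+1%:R x) = (fun=> 0).
    by apply/funext => x; rewrite subrr.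
  by rewrite complex_Lnorm0// lee_fin ltW.
- move=> n x; rewrite smooth_bumpE// normc_cindic /cindic indicE.
  case: ifPn => [/andP[ax xb]|xab].
    rewrite mem_set; last by rewrite /= in_itv/= ax.
    rewrite mulr1n -rmorphB normc_real -expRD.
    have e1 : expR (- (n.+1%:R * (x - a))^-1 + - (n.+1%:R * (b - x))^-1) <= 1.
      by rewrite expR_le1 -opprD oppr_le0 addr_ge0// invr_ge0 mulr_ge0// subr_ge0 ltW.
    by rewrite ger0_norm ?subr_ge0// lerBlDr lerDl expR_ge0.
  rewrite memNset; last by rewrite /= in_itv/=; exact/negP.
  by rewrite mulr0n subr0 normc_real normr0.
- by [].
move=> x; rewrite /cindic indicE; case: (boolP ((a < x) && (x < b))) => xab; last first.
  rewrite memNset; last by rewrite /= in_itv/=; exact/negP.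
  under eq_fun do rewrite smooth_bumpE// (negbTE xab) subrr Normc.normc0.
  exact: cvg_cst.
rewrite mem_set; last by rewrite /= in_itv/=.
rewrite mulr1n; move/andP : xab => [ax xb].
pose s := (x - a)^-1 + (b - x)^-1.
have E n : Normc.normc (1%:C - smooth_bump a b n.+1%:R x) = `|1 - expR (- (s * n.+1%:R^-1))|.
  rewrite smooth_bumpE// ax xb -rmorphB normc_real -expRD; congr `|1 - expR _|.
  by rewrite /s !invfM; ring.
rewrite (_ : (fun n => _) = (fun n => `|1 - expR (- (s * n.+1%:R^-1))|)); last first.
  by apply/funext => n; rewrite -E.
apply/norm_cvg0P; rewrite -(subrr 1); apply: cvgB; first exact: cvg_cst.
rewrite -[X in _ --> X](@expR0 R); apply: continuous_cvg; first exact: continuous_expR.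
rewrite -[X in _ --> X]oppr0; apply: cvgN; rewrite -[X in _ --> X](mulr0 s).
by apply: cvgMr; exact: cvg_harmonic.
Qed.

Lemma approximable0 : approximable (fun=> 0).
Proof.
have -> : (fun=> 0) = cindic `](0 : R), 0[.
  by apply/funext => x; rewrite /cindic indicE memNset//= in_itv/= => /andP[? ?]; lra.
exact: approximable_itv.
Qed.

Lemma approximable_sum (c : nat -> R[i]) (h : nat -> R -> R[i]) n :
  (forall i, approximable (h i)) -> approximable (fun x => \sum_(i < n) c i * h i x).
Proof.
move=> ah; elim: n => [|n ih].
  by under eq_fun do rewrite big_ord0; exact: approximable0.
under eq_fun do rewrite big_ord_recr/= addrC.
exact: approximable_lin.
Qed.

(** The sets S for which the indicator of S cut by ]-k, k[ is approximable form a
    Dynkin system, and the rays ]-oo, x[ are a generating pi-system inside it.  The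
    cut keeps every indicator in L^p, in particular those of complements. *)
Lemma approximable_indic (k : R) (A : set R) : measurable A ->
  approximable (cindic (A `&` `]-k, k[)).
Proof.
pose I := `]-k, k[%classic.
suff: forall S, <<s @RGenInftyO.G R >> S -> approximable (cindic (S `&` I)).
  move=> + mA; apply; change ((@RGenInftyO.G R).-sigma.-measurable A).
  by rewrite -RGenInftyO.measurableE.
apply: (@dynkin_induction _ (measurableTypeR R) (@RGenInftyO.G R)
  (fun S => approximable (cindic (S `&` I)))).
- exact: RGenInftyO.measurableE.
- move=> _ _ [x ->] [y ->]; exists (Num.min x y); apply/seteqP; split => z /=;
    rewrite !in_itv/= lt_min; [by move=> [-> ->]|by move/andP].
- by rewrite setTI; exact: approximable_itv.
- move=> _ [x ->]; have -> : `]-oo, x[%classic `&` I = `]-k, Num.min x k[%classic.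
    apply/seteqP; split => z; rewrite /I /= !in_itv/= lt_min.
      by move=> [-> /andP[-> ->]].
    by move=> /and3P[-> -> ->].
  exact: approximable_itv.
- move=> S mS aS.
  have -> : cindic (~` S `&` I) = (fun x => -1 * cindic (S `&` I) x + cindic I x).
    apply/funext => x; rewrite /cindic !indicE !in_setI in_setC mulN1r -rmorphN -rmorphD.
    by case: (x \in S); case: (x \in I) => /=; rewrite ?oppr0 ?addr0 ?add0r ?addNr.
  by apply: approximable_lin => //; exact: approximable_itv.
move=> F mF tF aF.
pose U n := \big[setU/set0]_(i < n) F i.
have mU n : measurable (U n) by apply: bigsetU_measurable => i _; exact: mF.
have aU n : approximable (cindic (U n `&` I)).
  elim: n => [|n ih].
    rewrite /U big_ord0 set0I (_ : cindic set0 = fun=> 0); first exact: approximable0.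
    by apply/funext => x; rewrite /cindic indic0.
  have -> : cindic (U n.+1 `&` I) = (fun x => 1 * cindic (U n `&` I) x + cindic (F n `&` I) x).
    apply/funext => x; rewrite /cindic mul1r -rmorphD; congr (_ %:C).
    rewrite /U big_ord_recr/= -/(U n) !indicE !in_setI in_setU.
    case: (boolP (x \in U n)) => xU; case: (boolP (x \in F n)) => xF; case: (x \in I);
      rewrite //= ?addr0 ?add0r//.
    exfalso; move: xU xF; rewrite !inE /U -bigcup_mkord => -[i /= ni Fix] Fnx.
    have := tF i n Logic.I Logic.I (ex_intro _ x (conj Fix Fnx)).
    by move=> inE_; move: ni; rewrite inE_ ltnn.
  exact: approximable_lin.
set V := \bigcup_k F k.
have UV n x : x \in U n -> x \in V.
  by rewrite !inE /U -bigcup_mkord => -[i _ Fix]; exists i.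
have diffE n x : Normc.normc (cindic (V `&` I) x - cindic (U n `&` I) x) =
    ((x \in V) && (x \notin U n) && (x \in I))%:R.
  rewrite /cindic -rmorphB normc_real !indicE !in_setI.
  have := @UV n x; case: (x \in U n) => [/(_ isT) ->|_] /=.
    by rewrite subrr normr0.
  by rewrite andbT subr0 normr_nat.
apply: (@approximable_dominated _ (cindic I) (fun n => cindic (U n `&` I))).
- apply: complex_measurable_cindic; apply: measurableI; last exact: measurable_itv.
  exact: (bigcup_measurable (fun i _ => mF i)).
- exact: cindic_Lfun.
- exact: aU.
- move=> n x; rewrite diffE normc_cindic indicE ler_nat.
  by case: (x \in I); rewrite ?andbF//; exact: leq_b1.
- move=> x; rewrite !normc_cindic !indicE in_setI ler_nat.
  by case: (x \in I); rewrite ?andbF//; exact: leq_b1.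
move=> x; case: (boolP (x \in V)) => xV; last first.
  under eq_fun do rewrite diffE (negbTE xV)/=.
  exact: cvg_cst.
move: (xV); rewrite inE => -[k0 _ Fk0].
apply: cvg_near_cst; exists k0.+1 => // n kn; rewrite [LHS]diffE.
have -> : x \in U n by rewrite inE /U -bigcup_mkord; exists k0.
by rewrite andbF.
Qed.

Import HBNNSimple.

Lemma approximable_sfun (k : R) (phi : {nnsfun R >-> R}) :
  approximable (fun x => (phi x * \1_`]-k, k[ x)%:C).
Proof.
have [n [s phiE]] : exists n (s : nat -> R), forall x,
    phi x = \sum_(i < n) s i * \1_(phi @^-1` [set s i]) x.
  by do 2 eexists; exact: fimfunEord.
have -> : (fun x => (phi x * \1_`]-k, k[ x)%:C) = (fun x =>
    \sum_(i < n) (s i)%:C * cindic (phi @^-1` [set s i] `&` `]-k, k[) x).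
  apply/funext => x; rewrite phiE mulr_suml rmorph_sum; apply: eq_bigr => i _.
  by rewrite /cindic indicI /= -mulrA rmorphM.
apply: (approximable_sum (fun i => (s i)%:C)
   (h := fun i => cindic (phi @^-1` [set s i] `&` `]-k, k[))).
move=> i; apply: approximable_indic; apply: (measurable_funPTI phi); exact: measurable_set1.
Qed.

(** Simple functions increasing to f, cut off outside ]-n, n[ so that each of them
    is a combination of indicators of bounded sets. *)
Lemma approximable_ge0 (f : R -> R) : (forall x, 0 <= f x) ->
  complex_Lfun p%:E (fun x => (f x)%:C) -> approximable (fun x => (f x)%:C).
Proof.
move=> f0 Lf; have [[mf _] _] := Lf.
have mEf : measurable_fun setT (EFin \o f) by exact/measurable_EFinP.
pose phi := nnsfun_approx measurableT mEf.
have phi_le n x : phi n x <= f x.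
  rewrite -lee_fin /phi nnsfun_approxE; apply: (@le_approx _ _ _ setT (EFin \o f)) => //.
  by move=> y _ /=; rewrite lee_fin.
have phi_cvg x : (phi^~ x) @ \oo --> f x.
  have := @cvg_nnsfun_approx _ _ _ setT measurableT (EFin \o f) mEf _ x I.
  move=> /(_ _)/fine_cvgP[|//].
  by move=> y _ /=; rewrite lee_fin.
have dE n x : Normc.normc ((f x)%:C - (phi n x * \1_`](- n%:R), n%:R[ x)%:C) =
    f x - phi n x * \1_`](- n%:R), n%:R[ x.
  rewrite -rmorphB normc_real ger0_norm// subr_ge0 indicE.
  by case: (_ \in _); rewrite ?mulr1 ?mulr0.
apply: (@approximable_dominated _ (fun x => (f x)%:C)
  (fun n x => (phi n x * \1_`](- n%:R), n%:R[ x)%:C)) => //.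
- by move=> n; exact: approximable_sfun.
- move=> n x; rewrite dE normc_real ger0_norm// gerBl mulr_ge0//.
move=> x; have -> : (fun n => Normc.normc ((f x)%:C -
    (phi n x * \1_`](- n%:R), n%:R[ x)%:C)) =
    (fun n => f x - phi n x * \1_`](- n%:R), n%:R[ x) by apply/funext => n; exact: dE.
rewrite -[X in _ --> X](subrr (f x)); apply: cvgB; first exact: cvg_cst.
apply: cvg_trans (phi_cvg x); apply: near_eq_cvg.
exists (Num.truncn `|x|).+1 => // n /= xn; rewrite indicE mem_set ?mulr1//=.
rewrite in_itv/= -ltr_norml; apply: lt_le_trans (truncnS_gt _) _.
by rewrite ler_nat.
Qed.

Lemma Cc_infty_dense f : complex_Lfun p%:E f -> approximable f.
Proof.
move=> Lf; have [mf Nf] := Lf; have [fr fi] := mf.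
have sub (h : R -> R) : measurable_fun setT h -> (forall x, 0 <= h x) ->
    (forall x, h x <= Normc.normc (f x)) -> approximable (fun x => (h x)%:C).
  move=> mh h0 hf; apply: approximable_ge0 => //; split; first exact: complex_measurable_real.
  apply: le_lt_trans Nf; apply: complex_Lnorm_le_ae => //.
  by apply: ae_all => x; rewrite normc_real ger0_norm.
have real_part (h : R -> R) : measurable_fun setT h ->
    (forall x, `|h x| <= Normc.normc (f x)) -> approximable (fun x => (h x)%:C).
  move=> mh hf.
  have -> : (fun x => (h x)%:C) =
      (fun x => -1 * (Num.max (- h x) 0)%:C + (Num.max (h x) 0)%:C).
    apply/funext => x; rewrite mulN1r -rmorphN -rmorphD; congr (_ %:C).
    by rewrite /Num.max; case: ltP => ?; case: ltP => ?; lra.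
  apply: approximable_lin; apply: sub => //.
  - by apply: measurable_maxr => //; exact: measurableT_comp.
  - by move=> x; rewrite le_max lexx orbT.
  - move=> x; rewrite ge_max normc_ge0 andbT; apply: le_trans (hf x).
    by rewrite -normrN ler_norm.
  - exact: measurable_maxr.
  - by move=> x; rewrite le_max lexx orbT.
  - move=> x; rewrite ge_max normc_ge0 andbT; apply: le_trans (hf x).
    exact: ler_norm.
have -> : f = (fun x => 'i * (complex.Im (f x))%:C + (complex.Re (f x))%:C).
  by apply/funext => x; rewrite [LHS]complexE addrC.
apply: approximable_lin; apply: real_part => // x; [exact: Im_le_normc|exact: Re_le_normc].
Qed.

End density.

(** * Extension of bounded operators from test functions *)

Section extension.
Context {R : realType}.
Variable p : R.
Hypothesis p1 : 1 <= p.
Local Notation mu := (@lebesgue_measure R).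
Local Notation N f := (complex_Lnorm p%:E f%R).
Variables (S : (R -> R[i]) -> (R -> R[i])) (K : R).
Hypothesis K0 : 0 <= K.
Hypothesis S_meas : forall f, Cc_infty f -> complex_measurable (S f).
Hypothesis S_lin : forall (a : R[i]) f g, Cc_infty f -> Cc_infty g ->
  forall x, S (fun x => a * f x + g x) x = a * S f x + S g x.
Hypothesis S_bound : forall f, Cc_infty f -> (N (S f) <= K%:E * N f)%E.

(** The closure in L^p x L^p of the graph of S.  Boundedness of S makes this
    closure the graph of the extension, so that existence, uniqueness, linearity
    and the norm bound of the extension become statements on a relation, free of
    any choice of approximating sequences. *)
Definition closure_graph (f h : R -> R[i]) : Prop := complex_Lfun p%:E h /\
  forall e : R, 0 < e -> exists g, [/\ Cc_infty g,
    (N (fun x => f x - g x) <= e%:E)%E & (N (fun x => h x - S g x) <= e%:E)%E].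

Let Cc_Lfun f : Cc_infty f -> complex_Lfun p%:E f.
Proof. exact: Cc_infty_Lfun. Qed.

Lemma S_Lfun f : Cc_infty f -> complex_Lfun p%:E (S f).
Proof.
move=> Cf; split; first exact: S_meas.
apply: le_lt_trans (S_bound Cf) _; apply: lte_mul_pinfty => //.
by have [] := Cc_Lfun Cf.
Qed.

Lemma S_dist f g g' (d d' : R) : complex_Lfun p%:E f -> Cc_infty g -> Cc_infty g' ->
  (N (fun x => f x - g x) <= d%:E)%E -> (N (fun x => f x - g' x) <= d'%:E)%E ->
  (N (fun x => S g x - S g' x) <= (K * (d + d'))%:E)%E.
Proof.
move=> Lf Cg Cg' fg fg'.
have Cd : Cc_infty (fun x => -1 * g' x + g x) by exact: Cc_infty_lin.
have -> : (fun x => S g x - S g' x) = S (fun x => -1 * g' x + g x).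
  by apply/funext => x; rewrite S_lin// mulN1r addrC.
apply: le_trans (S_bound Cd) _; rewrite EFinM; apply: lee_wpmul2l => //.
have -> : (fun x => -1 * g' x + g x) = (fun x => (f x - g' x) - (f x - g x)).
  by apply/funext => x; ring.
apply: le_trans (complex_LnormB p1 _ _) _.
- by apply: complex_measurableB; [case: Lf|exact: complex_measurable_Cc].
- by apply: complex_measurableB; [case: Lf|exact: complex_measurable_Cc].
by rewrite addrC EFinD leeD.
Qed.

(** Test functions approaching f at speed 2^-n have images that converge almost
    everywhere by completeness; Fatou's lemma then bounds the distance between the
    images and their limit. *)
Lemma closure_graph_ex f : complex_Lfun p%:E f -> exists h, closure_graph f h.
Proof.
move=> Lf; have [_ af] := Cc_infty_dense p1 Lf.
(* this choice makes K (d n + d m) at most 2^-m for m <= n *)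
pose d n : R := 2^-1 ^+ n / (2 * (K + 1)).
have K1 : 0 < K + 1 by rewrite ltr_wpDl.
have h2 (n : nat) : 0 < 2^-1 ^+ n :> R by rewrite exprn_gt0// invr_gt0.
have d0 n : 0 < d n by rewrite divr_gt0// mulr_gt0.
have /choice[g Hg] : forall n, exists g, Cc_infty g /\ (N (fun x => f x - g x) <= (d n)%:E)%E.
  by move=> n; have [g Cg fg] := af _ (d0 n); exists g.
have Cg n : Cc_infty (g n) by have [] := Hg n.
have fg n : (N (fun x => f x - g n x) <= (d n)%:E)%E by have [] := Hg n.
have d_le m n : (m <= n)%N -> K * (d n + d m) <= 2^-1 ^+ m.
  move=> mn.
  have dnm : d n <= d m.
    rewrite ler_wpM2r ?invr_ge0 ?mulr_ge0 ?(ltW K1)//.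
    by apply: ler_wiXn2l => //; rewrite ?invr_ge0 ?invf_le1 ?ler1n.
  apply: (@le_trans _ _ (K * (d m + d m))); first by rewrite ler_wpM2l// lerD2r.
  have -> : K * (d m + d m) = 2^-1 ^+ m * (K / (K + 1)) by rewrite /d; field; rewrite gt_eqF.
  by rewrite ler_piMr ?(ltW (h2 m))// ler_pdivrMr// mul1r lerDl.
have dist m n : (m <= n)%N -> (N (fun x => S (g n) x - S (g m) x) <= (2^-1 ^+ m)%:E)%E.
  move=> mn; apply: le_trans (S_dist Lf (Cg n) (Cg m) (fg n) (fg m)) _.
  by rewrite lee_fin d_le.
have [h mh hh] := complex_Lp_complete p1 (fun n => S_meas (Cg n)) (fun n => dist n n.+1 (leqnSn n)).
have hdist m : (N (fun x => h x - S (g m) x) <= (2^-1 ^+ m)%:E)%E.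
  apply: (@complex_Lnorm_fatou _ p p1 (fun n x => S (g (n + m)%N) x - S (g m) x)).
  - exact: ltW.
  - by move=> n; apply: complex_measurableB; exact: S_meas.
  - by apply: complex_measurableB => //; exact: S_meas.
  - apply: ae_imp hh => x hx.
    have -> : (fun n => Normc.normc (S (g (n + m)%N) x - S (g m) x - (h x - S (g m) x))) =
        (fun n => (fun n => Normc.normc (S (g n) x - h x)) (n + m)%N).
      by apply/funext => n /=; congr Normc.normc; ring.
    by have := hx; rewrite -(cvg_shiftn m).
  - by move=> n; apply: dist; exact: leq_addl.
exists h; split.
  split => //; have -> : h = (fun x => (h x - S (g 0%N) x) + S (g 0%N) x).
    by apply/funext => x; rewrite subrK.
  apply: le_lt_trans (complex_LnormD p1 _ _) _.
  - by apply: complex_measurableB => //; exact: S_meas.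
  - exact: S_meas.
  apply: lte_add_pinfty; last by have [] := S_Lfun (Cg 0%N).
  by apply: le_lt_trans (hdist 0%N) _; exact: ltry.
move=> e e0.
have : (fun n => (2^-1 : R) ^+ n) @ \oo --> (0 : R).
  by apply: cvg_expr; rewrite ger0_norm ?invr_ge0// invf_lt1// ltr1n.
move/cvgrPdist_le => /(_ _ e0)[n _ /(_ n (leqnn n))] /=.
rewrite sub0r normrN ger0_norm ?(ltW (h2 n))// => ne.
exists (g n); split => //.
  apply: le_trans (fg n) _; rewrite lee_fin; apply: le_trans ne.
  rewrite /d ler_pdivrMr ?mulr_gt0// ler_peMr ?(ltW (h2 n))//; have K0' := K0; lra.
by apply: le_trans (hdist n) _; rewrite lee_fin.
Qed.

Lemma closure_graph_lin (a : R[i]) f g h k :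
  complex_Lfun p%:E f -> complex_Lfun p%:E g ->
  closure_graph f h -> closure_graph g k ->
  closure_graph (fun x => a * f x + g x) (fun x => a * h x + k x).
Proof.
move=> Lf Lg [Lh fh] [Lk gk]; split; first exact: complex_Lfun_lin.
move=> e e0; pose d := e / (Normc.normc a + 1).
have a1 : 0 < Normc.normc a + 1 by rewrite ltr_wpDl ?normc_ge0.
have d0 : 0 < d by rewrite divr_gt0.
have [u [Cu fu hu]] := fh _ d0; have [v [Cv gv kv]] := gk _ d0.
have de (w z : R -> R[i]) : complex_measurable w -> complex_measurable z ->
    (N w <= d%:E)%E -> (N z <= d%:E)%E -> (N (fun x => a * w x + z x) <= e%:E)%E.
  move=> mw mz wd zd; apply: le_trans (complex_LnormD p1 _ mz) _.
    by apply: complex_measurableM => //; exact: complex_measurable_cst.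
  rewrite complex_LnormZ//.
  apply: (@le_trans _ _ ((Normc.normc a)%:E * d%:E + d%:E)%E).
    by apply: leeD => //; apply: lee_wpmul2l => //; rewrite lee_fin normc_ge0.
  rewrite -EFinM -EFinD lee_fin [leLHS](_ : _ = e)// /d.
  by field; rewrite gt_eqF.
exists (fun x => a * u x + v x); split; first exact: Cc_infty_lin.
- have -> : (fun x => a * f x + g x - (a * u x + v x)) =
    (fun x => a * (f x - u x) + (g x - v x)) by apply/funext => x; ring.
  apply: de => //; apply: complex_measurableB; try exact: complex_measurable_Cc.
    exact: Lf.1.
  exact: Lg.1.
- have -> : (fun x => a * h x + k x - S (fun x => a * u x + v x) x) =
    (fun x => a * (h x - S u x) + (k x - S v x)).
    by apply/funext => x; rewrite S_lin//; ring.
  apply: de => //; apply: complex_measurableB; try exact: S_meas; [exact: Lh.1|exact: Lk.1].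
Qed.

Lemma closure_graph_bound f h : complex_Lfun p%:E f -> closure_graph f h ->
  (N h <= K%:E * N f)%E.
Proof.
move=> [mf Nf] [[mh Nh] fh].
have Nffin : N f \is a fin_num by rewrite ge0_fin_numE// complex_Lnorm_ge0.
apply/lee_addgt0Pr => e e0.
have K1 : 0 < K + 1 by rewrite ltr_wpDl.
have [g [Cg fg hg]] := fh _ (divr_gt0 e0 K1).
set d := e / (K + 1) in fg hg.
have Ng : (N g <= N f + d%:E)%E.
  have -> : g = (fun x => f x - (f x - g x)) by apply/funext => x; rewrite subKr.
  apply: le_trans (complex_LnormB p1 mf _) _.
    by apply: complex_measurableB => //; exact: complex_measurable_Cc.
  exact: leeD.
have -> : h = (fun x => (h x - S g x) + S g x) by apply/funext => x; rewrite subrK.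
apply: le_trans (complex_LnormD p1 _ (S_meas Cg)) _.
  by apply: complex_measurableB => //; exact: S_meas.
apply: (@le_trans _ _ (d%:E + K%:E * (N f + d%:E)))%E.
  apply: leeD => //; apply: le_trans (S_bound Cg) _.
  by apply: lee_wpmul2l.
rewrite -(fineK Nffin) -EFinD -!EFinM -!EFinD lee_fin /d.
rewrite le_eqVlt; apply/orP; left; apply/eqP; field.
by rewrite gt_eqF.
Qed.

Lemma closure_graph_unique f h k : complex_Lfun p%:E f ->
  closure_graph f h -> closure_graph f k -> ae_eq mu setT h k.
Proof.
move=> Lf fh fk.
have d := closure_graph_lin (-1) Lf Lf fh fk.
have L0 := complex_Lfun_lin p1 (-1) Lf Lf.
have e0 : (fun x => -1 * f x + f x) = (fun=> 0) by apply/funext => x; rewrite mulN1r addNr.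
have := closure_graph_bound L0 d.
rewrite e0 complex_Lnorm0// mule0 => N0.
have : N (fun x => -1 * h x + k x) = 0%E.
  by apply/eqP; rewrite eq_le N0 complex_Lnorm_ge0.
move/(complex_Lnorm0_ae p1) => /(_ d.1.1).
apply: ae_imp => x /(_ I) + _; rewrite mulN1r addrC => /eqP; rewrite subr_eq0.
by move=> /eqP ->.
Qed.

Lemma closure_graph_test f : Cc_infty f -> closure_graph f (S f).
Proof.
move=> Cf; split; first exact: S_Lfun.
move=> e e0; exists f; split => //.
- have -> : (fun x => f x - f x) = (fun=> 0) by apply/funext => x; rewrite subrr.
  by rewrite complex_Lnorm0// lee_fin ltW.
- have -> : (fun x => S f x - S f x) = (fun=> 0) by apply/funext => x; rewrite subrr.
  by rewrite complex_Lnorm0// lee_fin ltW.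
Qed.

Lemma bounded_extension : exists T, [/\ bounded_Lp_operator p%:E T,
  forall f, Cc_infty f -> ae_eq mu setT (T f) (S f) &
  forall f, complex_Lfun p%:E f -> (N (T f) <= K%:E * N f)%E].
Proof.
have /choice[T HT] : forall f, exists h, complex_Lfun p%:E f -> closure_graph f h.
  move=> f; have [Lf|nLf] := pselect (complex_Lfun p%:E f).
    by have [h fh] := closure_graph_ex Lf; exists h.
  by exists f.
have bT f : complex_Lfun p%:E f -> (N (T f) <= K%:E * N f)%E.
  by move=> Lf; apply: closure_graph_bound => //; exact: HT.
exists T; split => //.
- split.
  + by move=> f Lf; have [] := HT f Lf.
  + move=> a f g Lf Lg.
    have Lfg := complex_Lfun_lin p1 a Lf Lg.
    apply: (closure_graph_unique Lfg (HT _ Lfg)).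
    by apply: closure_graph_lin => //; exact: HT.
  + by exists K.
- move=> f Cf; have Lf := Cc_Lfun Cf.
  by apply: (closure_graph_unique Lf (HT _ Lf)); exact: closure_graph_test.
Qed.

End extension.

(** * Rescaling a multiplier to the half-line *)

Section blow_up.
Context {R : realType}.
Variable p : R.
Hypothesis p1 : 1 <= p.
Local Notation mu := (@lebesgue_measure R).
Local Notation N f := (complex_Lnorm p%:E f%R).

Let p0 : 0 < p. Proof. exact: lt_le_trans p1. Qed.

Lemma Lp_operator_norm_ge0 T : (0 <= Lp_operator_norm p%:E T)%E.
Proof.
apply: le_trans (complex_Lnorm_ge0 p (T (fun=> 0 : R[i]))) _.
apply: ereal_sup_ubound; exists (fun=> 0 : R[i]) => //=.
by split; [exact: complex_Lfun0|rewrite complex_Lnorm0].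
Qed.

(** The operator T is homogeneous only up to null sets, which suffices to reduce to
    norm 1.  When f has norm 0 no such reduction exists, and the bound comes from the
    boundedness of T. *)
Lemma le_Lp_operator_norm T (K : R) f : bounded_Lp_operator p%:E T ->
  (Lp_operator_norm p%:E T <= K%:E)%E -> complex_Lfun p%:E f ->
  (N (T f) <= K%:E * N f)%E.
Proof.
move=> [TL Tlin [C TC]] TK Lf.
have [Nf0|Nf0] := eqVneq (N f) 0%E.
  by apply: le_trans (TC _ Lf) _; rewrite Nf0 !mule0.
have [mf Nfy] := Lf.
have Nffin : N f \is a fin_num by rewrite ge0_fin_numE// complex_Lnorm_ge0.
pose r := fine (N f).
have NfE : N f = r%:E by rewrite fineK.
have r0 : 0 < r by rewrite fine_gt0// Nfy lt0e Nf0 complex_Lnorm_ge0.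
have nr : Normc.normc r%:C = r by rewrite normc_real gtr0_norm.
have rn0 : r%:C != 0 :> R[i] by rewrite eq_complex/= eqxx andbT gt_eqF.
(* the summand 0 matches the shape in which linearity of T is stated *)
pose g x := (r^-1)%:C * f x + 0.
have L0 := @complex_Lfun0 _ p p1.
have Lg : complex_Lfun p%:E g by exact: complex_Lfun_lin.
have Ng : N g = 1%E.
  have -> : N g = N (fun x => (r^-1)%:C * f x) by apply: eq_complex_Lnorm => x; rewrite /g addr0.
  by rewrite complex_LnormZ// normc_real gtr0_norm ?invr_gt0// NfE -EFinM mulVf ?gt_eqF.
have fE : f = (fun x => r%:C * g x + 0).
  apply/funext => x; rewrite /g !addr0 mulrA -rmorphM mulfV ?gt_eqF//.
  by rewrite mul1r.
have T0 : ae_eq mu setT (T (fun=> 0)) (fun=> 0).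
  apply: (complex_Lnorm0_ae p1); first by have [] := TL _ L0.
  apply/eqP; rewrite eq_le complex_Lnorm_ge0 andbT.
  by apply: le_trans (TC _ L0) _; rewrite complex_Lnorm0// mule0.
have TfE : ae_eq mu setT (T f) (fun x => r%:C * T g x).
  have := Tlin r%:C g (fun=> 0) Lg L0; rewrite -fE => h.
  by apply: ae_imp2 h T0 => x + + _ => -> // ->//; rewrite addr0.
have [mTf _] := TL _ Lf; have [mTg _] := TL _ Lg.
rewrite (complex_Lnorm_ae_eq p1 _ _ TfE)//; last first.
  by apply: complex_measurableM => //; exact: complex_measurable_cst.
rewrite complex_LnormZ// nr NfE muleC; apply: lee_wpmul2r; first by rewrite lee_fin ltW.
apply: le_trans TK; apply: ereal_sup_ubound; exists g => //=.
by split => //; rewrite Ng.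
Qed.

Lemma complex_Lnorm_modulate (a e : R) g : e != 0 -> complex_measurable g ->
  N (modulate a e g) = (((`|e|^-1) `^ p^-1)%R%:E * N g)%E.
Proof.
move=> e0 mg; rewrite !complex_LnormE.
have -> : (\int[mu]_x (Normc.normc (modulate a e g x) `^ p)%:E =
    \int[mu]_x (fun y => (Normc.normc (g y) `^ p)%:E) (e * x + 0)%R)%E.
  by apply: eq_integral => x _; rewrite /modulate Normc.normcM normc_expi mul1r addr0.
rewrite (@ge0_integral_affine _ e 0 (fun y => (Normc.normc (g y) `^ p)%:E))//.
- by rewrite poweRM ?lee_fin ?invr_ge0// int_pow_ge0.
- exact: complex_measurable_pow.
- by move=> x; rewrite lee_fin powR_ge0.
Qed.

(** The factor |e|^(-1/p) produced by [modulate] appears on both sides and cancels. *)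
Lemma multiplier_bound_affine M T (K : R) (a e : R) f : ess_bounded M ->
  extends_multiplier_op p%:E M T -> (Lp_operator_norm p%:E T <= K%:E)%E ->
  e != 0 -> Cc_infty f ->
  (N (multiplier_op (fun u => M (e * u + a)%R) f) <= K%:E * N f)%E.
Proof.
move=> bM [bT Text] TK e0 Cf.
have Cmf := Cc_infty_modulate a e0 Cf.
have mf := complex_measurable_Cc Cf.
have := le_Lp_operator_norm bT TK (Cc_infty_Lfun p1 Cmf).
have bMa := ess_bounded_affine a e0 bM.
rewrite (complex_Lnorm_ae_eq p1 _ _ (Text _ Cmf)); last 2 first.
- by case: bT => TL _ _; have [] := TL _ (Cc_infty_Lfun p1 Cmf).
- exact: multiplier_op_measurable.
have -> : multiplier_op M (modulate a e f) =
    modulate a e (multiplier_op (fun u => M (e * u + a)) f).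
  by apply/funext => x; exact: multiplier_op_modulate.
rewrite !complex_Lnorm_modulate//; last exact: multiplier_op_measurable.
have c0 : 0 < (`|e|^-1) `^ p^-1 by rewrite powR_gt0// invr_gt0 normr_gt0.
by rewrite muleCA lee_pmul2l.
Qed.

Lemma ae_neq0 : {ae mu, forall x : R, x != 0}.
Proof.
exists [set 0]; split.
- exact: measurable_set1.
- exact: lebesgue_measure_set1.
- by move=> x /= /negP; rewrite negbK => /eqP.
Qed.

Lemma half_line_bounded : ess_bounded (@half_line R).
Proof.
split; last first.
  exists 1; apply: ae_all => x; rewrite /half_line; case: ifP => _.
    by rewrite Normc.normc1.
  by rewrite Normc.normc0.
have -> : @half_line R = cindic `]0, +oo[.
  apply/funext => x; rewrite /half_line /cindic indicE; case: ifPn => x0.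
    by rewrite mem_set//= in_itv/= x0.
  by rewrite memNset//= in_itv/= andbT; exact/negP.
by apply: complex_measurable_cindic; exact: measurable_itv.
Qed.

Lemma ae_foralln_lebesgue (P : nat -> R -> Prop) :
  (forall n, {ae mu, forall x, P n x}) -> {ae mu, forall x, forall n, P n x}.
Proof. by move=> h; exact: ae_foralln. Qed.

(** Dominated convergence on the frequency side gives the convergence of the
    rescaled operators at every point, and Fatou's lemma transfers their common
    bound to the limit. *)
Lemma half_line_bound M T (K : R) (a sigma : R) (c : R[i]) f : ess_bounded M ->
  extends_multiplier_op p%:E M T -> (Lp_operator_norm p%:E T <= K%:E)%E ->
  0 <= K -> sigma != 0 -> c != 0 ->
  (forall u : R, u != 0 ->
    (fun n => Normc.normc (M (sigma * n.+1%:R^-1 * u + a) - c * half_line u))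
      @ \oo --> (0 : R)) ->
  Cc_infty f ->
  (N (multiplier_op half_line f) <= (K / Normc.normc c)%:E * N f)%E.
Proof.
move=> bM Text TK K0 s0 c0 Mc Cf.
have e0 n : sigma * n.+1%:R^-1 != 0 by rewrite mulf_neq0// invr_neq0.
pose Mn n u := M (sigma * n.+1%:R^-1 * u + a).
have bMn n : ess_bounded (Mn n) by exact: ess_bounded_affine.
have mh := multiplier_op_measurable half_line_bounded Cf.
have [_ Nfy] := Cc_infty_Lfun p1 Cf.
have Nffin : N f \is a fin_num by rewrite ge0_fin_numE// complex_Lnorm_ge0.
have nc0 : 0 < Normc.normc c.
  rewrite lt_neqAle normc_ge0 andbT eq_sym; apply: contra c0 => /eqP.
  by move/Normc.eq0_normc => ->.
have ifc := Cc_infty_fourier_cintegrable Cf.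
have key : (N (fun x => c * multiplier_op half_line f x) <= (K * fine (N f))%:E)%E.
  apply: (@complex_Lnorm_fatou _ p p1 (fun n => multiplier_op (Mn n) f)).
  - by rewrite mulr_ge0// fine_ge0// complex_Lnorm_ge0.
  - by move=> n; exact: multiplier_op_measurable.
  - by apply: complex_measurableM => //; exact: complex_measurable_cst.
  - apply: ae_all => x.
    have -> : c * multiplier_op half_line f x =
        complex_integral (fun y => expi (2 * pi * x * y) * (c * half_line y * fourier f y)).
      rewrite /multiplier_op -complex_integralZ; last first.
        apply: cintegrable_expi; first exact: measurable_funM.
        exact: multiplier_integrable half_line_bounded Cf.
      by congr complex_integral; apply/funext => y; ring.
    have [_ [C MC]] := bM.
    apply: (@complex_integral_dominated _ _ _ (fun y => C * Normc.normc (fourier f y))).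
    + move=> n; apply: cintegrable_measurable.
      apply: cintegrable_expi; first exact: measurable_funM.
      exact: multiplier_integrable (bMn n) Cf.
    + apply: cintegrable_measurable; apply: cintegrable_expi; first exact: measurable_funM.
      have := cintegrableZ c (multiplier_integrable half_line_bounded Cf).
      by congr cintegrable; apply/funext => y; rewrite mulrA.
    + exact: (integrableZl measurableT C (integrable_normc ifc)).
    + apply: ae_imp ae_neq0 => u u0.
      have -> : (fun n => Normc.normc (expi (2 * pi * x * u) * (Mn n u * fourier f u) -
            expi (2 * pi * x * u) * (c * half_line u * fourier f u))) =
          (fun n => Normc.normc (Mn n u - c * half_line u) * Normc.normc (fourier f u)).
        by apply/funext => n; rewrite -mulrBr -mulrBl !Normc.normcM normc_expi mul1r.
      rewrite -[X in _ --> X](mul0r (Normc.normc (fourier f u))).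
      by apply: cvgMl; exact: Mc.
    + have : {ae mu, forall u, forall n, Normc.normc (Mn n u) <= C}.
        by apply: ae_foralln_lebesgue => n; exact: (ae_affine a (e0 n) MC).
      apply: ae_imp => u uC n; rewrite !Normc.normcM normc_expi mul1r.
      by rewrite ler_wpM2r ?normc_ge0.
  - move=> n; rewrite EFinM fineK//.
    exact: (multiplier_bound_affine a bM Text TK (e0 n) Cf).
move: key; rewrite complex_LnormZ// => key.
rewrite -(fineK Nffin) -EFinM -mulrA [_^-1 * _]mulrC mulrA [_ * _^-1]mulrC EFinM.
by rewrite lee_pdivlMl.
Qed.

(** The constant c_p refers to operators on all of L^p, hence the passage from test
    functions to an extension with the same bound. *)
Lemma cst_c_le_blow_up M T (K : R) (a sigma : R) (c : R[i]) : ess_bounded M ->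
  extends_multiplier_op p%:E M T -> (Lp_operator_norm p%:E T <= K%:E)%E ->
  0 <= K -> sigma != 0 -> c != 0 ->
  (forall u : R, u != 0 ->
    (fun n => Normc.normc (M (sigma * n.+1%:R^-1 * u + a) - c * half_line u))
      @ \oo --> (0 : R)) ->
  (@cst_c R p%:E <= (K / Normc.normc c)%:E)%E.
Proof.
move=> bM Text TK K0 s0 c0 Mc.
have Kc0 : 0 <= K / Normc.normc c by rewrite divr_ge0// normc_ge0.
have [T' [bT' T'ext T'b]] := @bounded_extension _ p p1 (multiplier_op half_line) _ Kc0
  (fun f Cf => multiplier_op_measurable half_line_bounded Cf)
  (fun b f g Cf Cg x => multiplier_op_lin b x half_line_bounded Cf Cg)
  (fun f Cf => half_line_bound bM Text TK K0 s0 c0 Mc Cf).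
apply: (@le_trans _ _ (Lp_operator_norm p%:E T')).
  by apply: ereal_inf_lbound; exists T'.
apply: ge_ereal_sup => _ [f [Lf Nf] <-].
apply: le_trans (T'b _ Lf) _.
by rewrite -[leRHS]mule1; apply: lee_wpmul2l.
Qed.

End blow_up.

(** * Behaviour of the spread multiplier at the edges of its gap *)

Section spread_limits.
Context {R : realType}.
Local Notation mu := (@lebesgue_measure R).

Lemma Linfty_ess_bounded (m : R -> R[i]) : complex_Lfun +oo%E m -> ess_bounded m.
Proof.
move=> [mm]; rewrite /complex_Lnorm unlock.
have mupos : (0 < mu [set: R])%E.
  apply: (@lt_le_trans _ _ (mu `]0, 1])).
    by rewrite [X in (_ < X)%E]lebesgue_measure_itv/= lte_fin ltr01 -EFinB lte_fin subr0 ltr01.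
  by apply: le_measure; rewrite ?inE.
rewrite mupos => Ny; split => //.
have h := ess_sup_ge mu (abse \o (fun x => (Normc.normc (m x))%:E)).
move: Ny h; case: (ess_sup _ _) => [C| |] // _ h.
  exists C; apply: ae_imp h => x /=.
  by rewrite lee_fin ger0_norm// normc_ge0.
by exists 0; apply: ae_imp h => x /=; rewrite leeNy_eq.
Qed.

(** The distance in the normed space C is the modulus seen as a complex number; this
    brings it back to a real inequality. *)
Lemma cvg_normc_near (m : R -> R[i]) (F : set_system R) {FF : Filter F} (l : R[i]) :
  (m x : R[i]^o) @[x --> F] --> (l : R[i]^o) ->
  forall e : R, 0 < e -> F [set x | Normc.normc (m x - l) < e].
Proof.
move=> /cvgrPdist_lt ml e e0.
have ec : 0 < e%:C :> R[i] by rewrite ltcR.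
apply: filterS (ml _ ec) => x h; change (Normc.normc (m x - l) < e).
by rewrite normc_sub; move: h; rewrite normc_def ltcR; case: (l - m x).
Qed.

Lemma ess_boundedM (f g : R -> R[i]) : ess_bounded f -> ess_bounded g ->
  ess_bounded (fun x => f x * g x).
Proof.
move=> [mf [C fC]] [mg [D gD]]; split; first exact: complex_measurableM.
exists (C * D); apply: ae_imp2 fC gD => x fC gD.
by rewrite Normc.normcM ler_pM ?normc_ge0.
Qed.

Lemma ess_boundedD (f g : R -> R[i]) : ess_bounded f -> ess_bounded g ->
  ess_bounded (fun x => f x + g x).
Proof.
move=> [mf [C fC]] [mg [D gD]]; split; first exact: complex_measurableD.
exists (C + D); apply: ae_imp2 fC gD => x fC gD.
by apply: le_trans (le_normcD _ _) _; rewrite lerD.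
Qed.

Lemma spread_ess_bounded (t : R) (m : R -> R[i]) :
  ess_bounded m -> ess_bounded (spread t m).
Proof.
move=> bm.
have bh := @half_line_bounded R.
have bp : ess_bounded (pos_part m).
  have := ess_boundedM bh bm; congr ess_bounded; apply/funext => x.
  by rewrite /half_line /pos_part; case: ifP; rewrite ?mul1r ?mul0r.
have bn : ess_bounded (neg_part m).
  have N1 : (-1 : R) != 0 by rewrite oppr_eq0 oner_neq0.
  have := ess_boundedM (ess_bounded_affine 0 N1 bh) bm; congr ess_bounded.
  apply/funext => x; rewrite /half_line /neg_part addr0 mulN1r oppr_gt0.
  by case: ifP; rewrite ?mul1r ?mul0r.
have := ess_boundedD (ess_bounded_affine (- t) (oner_neq0 R) bp)
  (ess_bounded_affine t (oner_neq0 R) bn).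
by congr ess_bounded; apply/funext => x; rewrite mul1r.
Qed.

(** Within distance t of the edge t, the translate of the negative part of m
    contributes nothing: its argument s + 2 t is positive. *)
Lemma spread_near_right (t s : R) (m : R -> R[i]) : `|s| < t ->
  spread t m (s + t) = if 0 < s then m s else 0.
Proof.
rewrite ltr_norml => /andP[ts st].
rewrite /spread /pos_part /neg_part addrK [_ < 0](_ : _ = false) ?addr0//.
by apply/negbTE; rewrite -leNgt; lra.
Qed.

(** As at the right edge, with the roles of the two parts exchanged. *)
Lemma spread_near_left (t s : R) (m : R -> R[i]) : `|s| < t ->
  spread t m (s - t) = if s < 0 then m s else 0.
Proof.
rewrite ltr_norml => /andP[ts st].
rewrite /spread /pos_part /neg_part subrK [0 < _](_ : _ = false) ?add0r//.
by apply/negbTE; rewrite -leNgt; lra.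
Qed.

Lemma harmonic_small (u d : R) : 0 < d ->
  \forall n \near \oo, `|n.+1%:R^-1 * u| < d.
Proof.
move=> d0.
have : (fun n => n.+1%:R^-1 * u) @ \oo --> (0 : R).
  by rewrite -[X in _ --> X](mul0r u); apply: cvgMl; exact: cvg_harmonic.
move/cvgrPdist_lt => /(_ _ d0); apply: filterS => n.
by rewrite sub0r normrN.
Qed.

Lemma spread_blow_up_right (m : R -> R[i]) (lp : R[i]) (t : R) : 0 < t ->
  (m x : R[i]^o) @[x --> (0 : R)^'+] --> (lp : R[i]^o) ->
  forall u : R, u != 0 ->
  (fun n => Normc.normc (spread t m (1 * n.+1%:R^-1 * u + t) - lp * half_line u))
    @ \oo --> (0 : R).
Proof.
move=> t0 mlp u u0; apply/cvgrPdist_le => /= e e0.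
have : nbhs (0 : R) [set x | 0 < x -> Normc.normc (m x - lp) < e].
  exact: cvg_normc_near mlp _ e0.
move/nbhs_ballP => [d /= d0 md].
near=> n.
have nt : `|n.+1%:R^-1 * u| < t by near: n; exact: harmonic_small.
have nd : `|n.+1%:R^-1 * u| < d by near: n; exact: harmonic_small.
rewrite mul1r spread_near_right// pmulr_rgt0 ?invr_gt0// /half_line.
rewrite sub0r normrN ger0_norm ?normc_ge0//.
case: ifPn => up; last by rewrite mulr0 subrr Normc.normc0 ltW.
rewrite mulr1 ltW//; apply: md; first by rewrite /ball/= sub0r normrN.
by rewrite mulr_gt0// invr_gt0.
Unshelve. all: by end_near. Qed.

(** The dilation by -1/n reflects the axis, which turns a jump from the limit on the
    left to 0 into a multiple of the half-line multiplier. *)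
Lemma spread_blow_up_left (m : R -> R[i]) (lm : R[i]) (t : R) : 0 < t ->
  (m x : R[i]^o) @[x --> (0 : R)^'-] --> (lm : R[i]^o) ->
  forall u : R, u != 0 ->
  (fun n => Normc.normc (spread t m (-1 * n.+1%:R^-1 * u + - t) - lm * half_line u))
    @ \oo --> (0 : R).
Proof.
move=> t0 mlm u u0; apply/cvgrPdist_le => /= e e0.
have : nbhs (0 : R) [set x | x < 0 -> Normc.normc (m x - lm) < e].
  exact: cvg_normc_near mlm _ e0.
move/nbhs_ballP => [d /= d0 md].
near=> n.
have nt : `|- (n.+1%:R^-1 * u)| < t by rewrite normrN; near: n; exact: harmonic_small.
have nd : `|- (n.+1%:R^-1 * u)| < d by rewrite normrN; near: n; exact: harmonic_small.
rewrite -mulrA mulN1r spread_near_left// oppr_lt0 pmulr_rgt0 ?invr_gt0// /half_line.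
rewrite sub0r normrN ger0_norm ?normc_ge0//.
case: ifPn => up; last by rewrite mulr0 subrr Normc.normc0 ltW.
rewrite mulr1 ltW//; apply: md; first by rewrite /ball/= sub0r normrN.
by rewrite oppr_lt0 mulr_gt0// invr_gt0.
Unshelve. all: by end_near. Qed.

End spread_limits.

(** The bound holds for every extension T of the operator of M, hence for the
    infimum of their norms. *)
Lemma multiplier_norm_blow_up (R : realType) (p : R) (p1 : 1 <= p)
  (M : R -> R[i]) (a sigma : R) (c : R[i]) : ess_bounded M ->
  sigma != 0 -> c != 0 ->
  (forall u : R, u != 0 ->
    (fun n => Normc.normc (M (sigma * n.+1%:R^-1 * u + a) - c * half_line u))
      @ \oo --> (0 : R)) ->
  ((Normc.normc c)%:E * cst_c p%:E <= multiplier_norm p%:E M)%E.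
Proof.
move=> bM s0 c0 Mc; apply: le_ereal_inf_tmp => _ [T Text <-].
have nc0 : 0 < Normc.normc c.
  rewrite lt_neqAle normc_ge0 andbT eq_sym; apply: contra c0 => /eqP.
  by move/Normc.eq0_normc => ->.
have := Lp_operator_norm_ge0 p1 T.
case E : (Lp_operator_norm p%:E T) => [K| |] // K0; last by rewrite leey.
have TK : (Lp_operator_norm p%:E T <= K%:E)%E by rewrite E.
rewrite lee_fin in K0.
rewrite -lee_pdivlMl// -EFinM mulrC.
exact: (cst_c_le_blow_up p1 bM Text TK K0 s0 c0 Mc).
Qed.

Theorem theorem4p3 (R : realType) (p : R) (hp : 1 < p)
  (m : R -> R[i]) (m_Linfty : complex_Lfun +oo%E m)
  (m_mult : fourier_multiplier p%:E m)
  (lp lm : R[i])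
  (m_lp : (m x : R[i]^o) @[x --> (0 : R)^'+] --> (lp : R[i]^o))
  (m_lm : (m x : R[i]^o) @[x --> (0 : R)^'-] --> (lm : R[i]^o))
  (l : R) (l_def : l = Num.max (Normc.normc lp) (Normc.normc lm))
  (l_gt0 : 0 < l) :
  forall t : R, 0 < t ->
    (multiplier_norm p%:E (spread t m) >= l%:E * cst_c p%:E)%E.
Proof.
move=> t t0; have bS := spread_ess_bounded t (Linfty_ess_bounded m_Linfty).
have cn0 (c : R[i]) : 0 < Normc.normc c -> c != 0.
  by apply: contraTneq => ->; rewrite Normc.normc0 ltxx.
(* the edge of the gap is chosen where the one-sided limit has the larger modulus *)
have [ml|ml] := leP (Normc.normc lp) (Normc.normc lm).
  have lE : l = Normc.normc lm by rewrite l_def; exact/max_idPr.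
  rewrite lE in l_gt0 *.
  apply: (multiplier_norm_blow_up (ltW hp) bS _ (cn0 _ l_gt0)
    (spread_blow_up_left t0 m_lm)).
  by rewrite oppr_eq0 oner_neq0.
have lE : l = Normc.normc lp by rewrite l_def; apply/max_idPl/ltW.
rewrite lE in l_gt0 *.
exact: (multiplier_norm_blow_up (ltW hp) bS (oner_neq0 R) (cn0 _ l_gt0)
  (spread_blow_up_right t0 m_lp)).
Qed.
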